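(* Let $X_{\rm hc}$ be the hard-core subshift over the free group $F_2=\langle a,b\rangle$. There exist two homomorphic sofic approximation sequences $\Sigma_{\rm unif}$ and $\Sigma_{\rm bip}$ of $F_2$ such that $$\frac15\le\operatorname{mdim}_{\Sigma_{\rm unif}}(X_{\rm hc})\le\frac9{20}<\frac12=\operatorname{mdim}_{\Sigma_{\rm bip}}(X_{\rm hc}).$$ In particular, the sofic mean dimension of a topologically mixing action can depend on the chosen sofic approximation, and both values can be positive and finite: the action $F_2\curvearrowright X_{\rm hc}$ is topologically mixing and has this property.
   Context: $F_2=\langle a,b\rangle$ is the free group on $a,b$, with identity $e$. Hard-core subshift: $X_{\rm hc}=\{x\in[0,1]^{F_2}: x_gx_{gs}=0\text{ for all }g\in F_2,\ s\in\{a,b\}\}$ (product topology), with $F_2$ acting by the left shift $(hx)_g=x_{h^{-1}g}$. Topologically mixing: an action $G\curvearrowright X$ is topologically mixing if for every pair of nonempty open sets $U,V\subseteq X$ there is a finite set $K\subseteq G$ such that $gU\cap V\neq\varnothing$ for every $g\notin K$. Homomorphic sofic approximation of $F_2$: a sequence $\Sigma=(\sigma_n:F_2\to\operatorname{Sym}(V_n))_{n\ge1}$ of group homomorphisms, with $V_n$ finite, $|V_n|\to\infty$, and $|\{v\in V_n:\sigma_n(g)v=v\}|/|V_n|\to0$ for every $g\ne e$. Microstates: let $G$ be a countable group acting continuously on a compact metrizable space $X$, and $\rho$ a continuous pseudometric on $X$. For $\varphi,\psi:V\to X$ ($V$ finite) put $\rho_2(\varphi,\psi)=\big(\frac1{|V|}\sum_{v\in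 V}\rho(\varphi(v),\psi(v))^2\big)^{1/2}$. For finite nonempty $F\subseteq G$, $\delta>0$ and $\sigma:G\to\operatorname{Sym}(V)$, let $\operatorname{Map}(\rho,F,\delta,\sigma)$ be the set of $\varphi:V\to X$ with $\rho_2(\varphi\circ\sigma(s),s\varphi)\le\delta$ for all $s\in F$, where $(s\varphi)(v)=s(\varphi(v))$. Sofic mean dimension: for a finite open cover $\gamma$ of a space $Y$, $\operatorname{ord}(\gamma)=\max_{y\in Y}\sum_{U\in\gamma}1_U(y)-1$, and $D(\gamma)=\min_\beta\operatorname{ord}(\beta)$ over finite open covers $\beta$ of $Y$ refining $\gamma$ (every member of $\beta$ is contained in a member of $\gamma$). For a finite open cover $\mathcal U$ of $X$, $\mathcal U^V$ is the product cover of $X^V$ and $D(\mathcal U,\rho,F,\delta,\sigma)=D(\mathcal U^V|_{\operatorname{Map}(\rho,F,\delta,\sigma)})$. Then $$\operatorname{mdim}_\Sigma(X)=\sup_{\mathcal U}\inf_F\inf_{\delta>0}\limsup_{n\to\infty}\frac{D(\mathcal U,\rho,F,\delta,\sigma_n)}{|V_n|},$$ where $\rho$ is a compatible metric on $X$ (the value does not depend on it), $\mathcal U$ ranges over finite open covers of $X$ and $F$ over finite nonempty subsets of $G$. *)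

(* Defs.v *)
From HB Require Import structures.
From mathcomp Require Import all_boot all_order all_algebra all_fingroup.
From mathcomp Require Import all_classical all_reals all_analysis.

Set Implicit Arguments.
Unset Strict Implicit.
Unset Printing Implicit Defensive.

Import Order.TTheory GRing.Theory Num.Theory.
Import numFieldNormedType.Exports.

Local Open Scope classical_set_scope.
Local Open Scope ring_scope.

(* The free group F_2, as freely reduced words. A letter is a pair (s, eps),
   where s = false stands for the generator a and s = true for b, and
   eps = true marks the inverse of that generator. *)

Definition letter : Type := (bool * bool)%type.

Definition linv (x : letter) : letter := (x.1, ~~ x.2).

Definition reduced (w : seq letter) : bool :=
  sorted (fun x y => y != linv x) w.

Definition lpush (x : letter) (w : seq letter) : seq letter :=
  if w is y :: w' then if y == linv x then w' else x :: w else [:: x].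

(* freely reduced form of the concatenation v ++ w, for w reduced *)
Definition wmul (v w : seq letter) : seq letter := foldr lpush w v.

Definition winv (w : seq letter) : seq letter := rev (map linv w).

Lemma linvK : involutive linv.
Proof. by case=> s e; rewrite /linv /= negbK. Qed.

Lemma reduced_behead x w : reduced (x :: w) -> reduced w.
Proof. exact: path_sorted. Qed.

Lemma lpush_cons x w : reduced (x :: w) -> lpush x w = x :: w.
Proof. by case: w => [//|y w] /= /andP[/negbTE ->]. Qed.

Lemma lpush_reduced x w : reduced w -> reduced (lpush x w).
Proof.
case: w => [//|y w] rw /=; case: ifPn => [_|yx].
- exact: reduced_behead rw.
- by rewrite /reduced /= yx.
Qed.

Lemma lpushK x w : reduced w -> lpush x (lpush (linv x) w) = w.
Proof.
case: w => [_ /=|y w rw /=]; first by rewrite eqxx.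
rewrite linvK; case: (eqVneq y x) => [yx|_].
- by rewrite -yx lpush_cons.
- by rewrite /= eqxx.
Qed.

Lemma wmul_reduced v w : reduced w -> reduced (wmul v w).
Proof. by move=> rw; elim: v => //= x v; exact: lpush_reduced. Qed.

Lemma wmul_lpush x v w : reduced w ->
  wmul (lpush x v) w = lpush x (wmul v w).
Proof.
move=> rw; case: v => [//|y v] /=; case: eqP => [->|//].
by rewrite lpushK// wmul_reduced.
Qed.

Lemma wmulA u v w : reduced w -> wmul u (wmul v w) = wmul (wmul u v) w.
Proof. by move=> rw; elim: u => //= x u ->; rewrite wmul_lpush. Qed.

Lemma wmulw0 w : reduced w -> wmul w [::] = w.
Proof.
elim: w => //= x w IH rw.
by rewrite IH ?(reduced_behead rw)// lpush_cons.
Qed.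

Lemma wmul_cat u v w : wmul (u ++ v) w = wmul u (wmul v w).
Proof. exact: foldr_cat. Qed.

Lemma winv_reduced w : reduced w -> reduced (winv w).
Proof.
rewrite /winv /reduced rev_sorted sorted_map.
case: w => // x w; apply: sub_path => y z; rewrite /= linvK.
by apply: contraNN => /eqP ->; rewrite eqxx.
Qed.

Lemma winvK : involutive winv.
Proof. by move=> w; rewrite /winv map_rev revK mapK//; exact: linvK. Qed.

Lemma wmulVw w : wmul (winv w) w = [::].
Proof.
elim: w => //= x w IH.
by rewrite /winv /= rev_cons -cats1 wmul_cat /= linvK eqxx.
Qed.

Record F2 := FreeWord { word :> seq letter; word_reduced : reduced word }.

HB.instance Definition _ := [isSub for word].
HB.instance Definition _ := [Countable of F2 by <:].

Definition F2_one : F2 := @FreeWord [::] isT.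
Definition F2_inv (g : F2) : F2 := FreeWord (winv_reduced (word_reduced g)).
Definition F2_mul (g h : F2) : F2 :=
  FreeWord (wmul_reduced g (word_reduced h)).

Lemma F2_mulA : associative F2_mul.
Proof. by move=> f g h; apply: val_inj; rewrite /= wmulA// word_reduced. Qed.

Lemma F2_mul1g : left_id F2_one F2_mul.
Proof. by move=> g; exact: val_inj. Qed.

Lemma F2_mulg1 : right_id F2_one F2_mul.
Proof. by move=> g; apply: val_inj; rewrite /= wmulw0// word_reduced. Qed.

Lemma F2_mulVg : left_inverse F2_one F2_inv F2_mul.
Proof. by move=> g; apply: val_inj; exact: wmulVw. Qed.

Lemma F2_mulgV : right_inverse F2_one F2_inv F2_mul.
Proof.
move=> g; apply: val_inj => /=.
by rewrite -{1}[word g]winvK wmulVw.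
Qed.

HB.instance Definition _ :=
  isGroup.Build F2 F2_mulA F2_mul1g F2_mulg1 F2_mulVg F2_mulgV.

Definition gen_a : F2 := @FreeWord [:: (false, false)] isT.
Definition gen_b : F2 := @FreeWord [:: (true, false)] isT.

(* Continuous left actions of a discrete group *)

Record cont_action (G : groupType) (X : topologicalType) := ContAction {
  cact :> G -> X -> X;
  cact1 : forall x, cact 1%g x = x;
  cactM : forall g h x, cact (g * h)%g x = cact g (cact h x);
  cact_continuous : forall g, continuous (cact g) }.

Definition topologically_mixing (G : groupType) (X : topologicalType)
    (T : cont_action G X) : Prop :=
  forall U V : set X, open U -> open V -> U !=set0 -> V !=set0 ->
  exists2 K : set G, finite_set K &
    forall g, ~ K g -> (T g @` U) `&` V !=set0.

(* The product of {perm V} composes from left to right, (s * t) v = t (s v),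
   so that Sym(V) with the usual composition of maps is its opposite; hence
   the explicit formulation of the homomorphism property. *)
Record hom_sofic_approximation (R : realType) (G : groupType) :=
  HomSoficApproximation {
    sofic_set : nat -> finType;
    sofic_map : forall n, G -> {perm (sofic_set n)};
    sofic_mapM : forall n g h v,
      sofic_map n (g * h)%g v = sofic_map n g (sofic_map n h v);
    sofic_card : (fun n => #|sofic_set n|) @ \oo --> \oo;
    sofic_free : forall g, g <> 1%g ->
      (#|[pred v | sofic_map n g v == v]|%:R
         / #|sofic_set n|%:R : R) @[n --> \oo] --> (0 : R) }.

Definition compatible_metric (R : realType) (X : topologicalType)
    (rho : X -> X -> R) : Prop :=
  [/\ forall x y, rho x y = 0 <-> x = y,
      forall x y, rho x y = rho y x,
      forall x y z, rho x z <= rho x y + rho y z &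
      forall x (A : set X), nbhs x A <->
        exists2 e : R, 0 < e & [set y | rho x y < e] `<=` A].

Section microstates.
Context {R : realType} {G : groupType} {X : topologicalType}.
Context (T : cont_action G X) (rho : X -> X -> R).

Definition rho2 (V : finType) (phi psi : V -> X) : R :=
  Num.sqrt (#|V|%:R^-1 * \sum_(v : V) rho (phi v) (psi v) ^+ 2).

Definition Map (F : set G) (delta : R) (V : finType) (sigma : G -> {perm V}) :
    set {ptws V -> X} :=
  [set phi | forall s, F s ->
     rho2 (fun v => phi (sigma s v)) (fun v => T s (phi v)) <= delta].

End microstates.

Definition finite_open_cover (Y : topologicalType) (c : set (set Y)) : Prop :=
  [/\ finite_set c, forall U, c U -> open U & \bigcup_(U in c) U = setT].

Definition refines (Y : Type) (b c : set (set Y)) : Prop :=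
  forall W, b W -> exists2 U, c U & W `<=` U.

(* -oo when Y is empty *)
Definition ord (R : realType) (Y : Type) (c : set (set Y)) : \bar R :=
  ereal_sup [set (\sum_(U \in c) (\1_U y : R) - 1)%:E | y in [set: Y]].

(* The values of ord on finite covers form a well-ordered set, so this
   infimum is a minimum. *)
Definition cover_dim (R : realType) (Y : topologicalType) (c : set (set Y)) :
    \bar R :=
  ereal_inf [set ord R b | b in [set b | finite_open_cover b /\ refines b c]].

(* The product cover c^V of X^V, restricted to the subspace A *)
Definition prod_cover (X : topologicalType) (c : set (set X)) (V : finType)
    (A : set {ptws V -> X}) : set (set (set_type A)) :=
  [set W | exists2 u : V -> set X, (forall v, c (u v)) &
     W = [set phi : set_type A | forall v, u v (\val phi v)]].

Definition mdim (R : realType) (G : groupType) (X : topologicalType)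
    (Sigma : hom_sofic_approximation R G) (T : cont_action G X)
    (rho : X -> X -> R) : \bar R :=
  ereal_sup [set
    ereal_inf [set
      ereal_inf [set
        limn_esup (fun n =>
          (cover_dim R
             (@prod_cover X c _ (Map T rho F delta (@sofic_map R G Sigma n)))
           * (#|sofic_set Sigma n|%:R^-1)%:E)%E)
      | delta in [set delta : R | 0 < delta]]
    | F in [set F : set G | finite_set F /\ F !=set0]]
  | c in [set c : set (set X) | finite_open_cover c]].

(* The hard-core subshift *)

Section hard_core.
Context (R : realType).

Definition hard_core_set : set {ptws F2 -> R} :=
  [set x | (forall g, 0 <= x g <= 1) /\
           (forall g s, s = gen_a \/ s = gen_b -> x g * x (g * s)%g = 0)].

Definition hard_core : topologicalType := set_type hard_core_set.

Definition lshift_F2 (h : F2) (x : {ptws F2 -> R}) : {ptws F2 -> R} :=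
  fun g => x (h^-1 * g)%g.

Lemma shift_hard_core h x : hard_core_set x -> hard_core_set (lshift_F2 h x).
Proof.
move=> [x01 x0]; split=> [g|g s sab]; first exact: x01.
by rewrite /lshift_F2 mulgA; exact: x0.
Qed.

Definition hard_core_shift (h : F2) (x : hard_core) : hard_core :=
  exist _ (lshift_F2 h (\val x)) (mem_set (shift_hard_core h (set_valP x))).

Lemma hard_core_shift1 x : hard_core_shift 1%g x = x.
Proof.
apply: val_inj => /=; apply/funext => g.
by rewrite /lshift_F2 invg1 mul1g.
Qed.

Lemma hard_core_shiftM g h x :
  hard_core_shift (g * h)%g x = hard_core_shift g (hard_core_shift h x).
Proof.
apply: val_inj => /=; apply/funext => k.
by rewrite /lshift_F2 invMg mulgA.
Qed.

Lemma hard_core_shift_continuous g : continuous (hard_core_shift g).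
Proof.
apply: continuous_comp_initial => x.
apply/cvg_sup; first exact/fmap_filter/(nbhs_filter (x : hard_core)).
move=> i; move: x.
apply: (@continuous_comp_initial _ hard_core _ (fun f : F2 -> R => f i)) => x.
apply: (@continuous_comp hard_core {ptws F2 -> R} R (\val)
  (proj (g^-1 * i)%g)).
- exact: initial_continuous.
- exact: (@proj_continuous F2 (fun=> R : topologicalType)).
Qed.

Definition hard_core_action : cont_action F2 hard_core :=
  ContAction hard_core_shift1 hard_core_shiftM hard_core_shift_continuous.

End hard_core.

(* Main.v *)
(* For every sofic approximation of [F2] by homomorphisms, the mean dimension
   of the hard-core shift is governed by the largest density [alpha] of
   independent sets in the Schreier graphs.
   An independent set [S] carries a cube [[0, 1]^S] of exact microstates, so
   the Lebesgue covering theorem gives [alpha] as a lower bound.  Conversely,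
   after lowering all values by a small threshold, an approximate microstate
   is supported on an independent set plus few bad vertices, hence is encoded
   by a point of a cube with few nonzero coordinates; the open stars of the
   Freudenthal triangulation then give a cover of small order.
   Two independent uniformly random permutations have few short cycles by a
   switching argument and no independent set of density [9 / 20] by a first
   moment bound, while every graph of degree 4 has one of density [1 / 5] up
   to loops.  The bipartite double cover has density exactly [1 / 2]. *)

Require Import Defs.
From HB Require Import structures.
From mathcomp Require Import all_boot all_order all_algebra all_fingroup.
From mathcomp Require Import zify.

Set Implicit Arguments.
Unset Strict Implicit.
Unset Printing Implicit Defensive.

Import Order.TTheory GRing.Theory Num.Theory.

(** * Permutations with few short cycles and no large independent set *)

(** At density [9 / 20] on [n = 20 * m] points the first moment is ['C(n - k, k) ^ 2 / 'C(n, k)]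
    with [k = 9 * m], because each of the two permutations sends a fixed [k]-set to a uniformly
    distributed one; it is at most [4 ^ -m]. Multiples of 20 keep the sizes integral, and
    probabilities are written as products of cardinalities. Large independent sets and short cycles
    each spoil at most a quarter of all pairs of permutations, so a good pair remains. The covering
    theorem comes from a cup product modulo 2 on a cubical grid, whose total over the grid is [1] by
    a discrete Stokes formula. For the upper bound, the obstacle is that microstates are equivariant
    only in mean square, while a sharp division into good and bad vertices would make the encoding
    discontinuous. The coordinates recorded at a vertex are therefore multiplied by a continuous
    weight that vanishes at good vertices. *)

Section letter_action.
Variable T : finType.
Implicit Types (P : {ffun bool -> {perm T}}) (x : letter) (w : seq letter).

Definition lact P x (v : T) : T := if x.2 then (P x.1)^-1%g v else P x.1 v.

Definition wact P w (v : T) : T := foldr (lact P) v w.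

Lemma lactK P x : cancel (lact P (linv x)) (lact P x).
Proof. by case: x => s [] v; rewrite /lact /= ?permK ?permKV. Qed.

Lemma lact_inj P x : injective (lact P x).
Proof. by apply: (can_inj (g := lact P (linv x))) => v; rewrite -{2}[x]linvK lactK. Qed.

Lemma wact_inj P w : injective (wact P w).
Proof. by elim: w => [//|x w IH] u v /= /lact_inj/IH. Qed.

Lemma wact_lpush P x w v : wact P (lpush x w) v = lact P x (wact P w v).
Proof.
case: w => [//|y w] /=; case: eqP => [->|//].
by rewrite lactK.
Qed.

Lemma wact_wmul P u w v : wact P (wmul u w) v = wact P u (wact P w v).
Proof. by elim: u => [//|x u IH] /=; rewrite wact_lpush IH. Qed.

(** Products of permutations compose from left to right, so in both branches the action of the
    letter [x] is followed by [tperm y z]; for an inverse letter this changes its generator on the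
    source side. *)
Definition switch P x (y z : T) : {ffun bool -> {perm T}} :=
  [ffun c => if c == x.1 then
     if x.2 then (tperm y z * P c)%g else (P c * tperm y z)%g else P c].

Lemma lact_switch_same P x y z u :
  lact (switch P x y z) x u = tperm y z (lact P x u).
Proof.
by rewrite /lact ffunE eqxx; case: x => c [] /=; rewrite ?invMg ?tpermV permM.
Qed.

Lemma lact_switch_inv P x y z u :
  lact (switch P x y z) (linv x) u = lact P (linv x) (tperm y z u).
Proof.
by rewrite /lact ffunE eqxx; case: x => c [] /=; rewrite ?invMg ?tpermV permM.
Qed.

Lemma lact_switch_other P x x' y z u : x' != x -> x' != linv x ->
  lact (switch P x y z) x' u = lact P x' u.
Proof.
case: x x' => [c e] [c' e'] ne ne'; rewrite /lact ffunE /=.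
by case: eqP => [cc|//]; move: ne ne'; rewrite cc /linv /= !xpair_eqE eqxx /=;
  case: e e' => -[].
Qed.

Lemma switchK P x y z : switch (switch P x y z) x y z = P.
Proof.
apply/ffunP => c; rewrite !ffunE; case: eqP => // _.
by case: x.2; rewrite ?mulgA ?tperm2 ?mul1g // -mulgA tperm2 mulg1.
Qed.

Variables (v : T) (r : seq letter).
Hypothesis r_red : reduced r.

(** The letters of [r] are applied from the left, whereas [wact] applies the last letter first;
    hence the [rev] in [card_word_fixes]. *)
Definition walk P k := foldl (fun u x => lact P x u) v (take k r).

Lemma walkS P k : (k < size r)%N ->
  walk P k.+1 = lact P (nth (false, false) r k) (walk P k).
Proof.
by move=> kr; rewrite /walk (take_nth (false, false)) // foldl_rcons.
Qed.

Definition first_return t j P :=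
  uniq [seq walk P k | k <- iota 0 t] && (walk P t == walk P j).

(* When the walk first returns, its last edge may be redirected to any vertex
   [z] off the walk without changing the previous steps; [P] is recovered from
   the new permutations, which bounds the probability of a return. *)
Lemma walk_switch t j P z : (t < size r)%N -> (j <= t)%N ->
  first_return t.+1 j P -> z \notin [seq walk P k | k <- iota 0 t.+1] ->
  let P' := switch P (nth (false, false) r t) (walk P j) z in
  (forall k, (k <= t)%N -> walk P' k = walk P k) /\ walk P' t.+1 = z.
Proof.
move=> tr jt /andP[uw /eqP wt] zw.
set x := nth _ r t; set y := walk P j => P'.
have wz k : (k <= t)%N -> walk P k != z.
  move=> kt; apply: contraNneq zw => <-; apply: map_f.
  by rewrite mem_iota ltnS.
have w_inj k k' : (k <= t)%N -> (k' <= t)%N -> walk P k = walk P k' -> k = k'.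
  move=> kt kt' e; apply/eqP.
  have := nth_uniq (walk P 0) (s := [seq walk P k | k <- iota 0 t.+1]) (i := k) (j := k').
  rewrite size_map size_iota !ltnS kt kt' uw => /(_ isT isT isT) <-.
  by rewrite !(nth_map 0) ?size_iota ?ltnS // !nth_iota ?ltnS // e.
have same : forall k, (k <= t)%N -> walk P' k = walk P k.
  elim=> [|k IH] kt; first by rewrite /walk take0.
  rewrite !walkS ?(ltn_trans kt tr) // IH ?(ltnW kt) //.
  set x' := nth _ r k.
  have [ex|nx] := eqVneq x' x.
    rewrite ex lact_switch_same tpermD //.
      rewrite /y -wt walkS // -/x (inj_eq (@lact_inj _ _)).
      by apply/eqP => /w_inj e; have := e (leqnn _) (ltnW kt); lia.
    by rewrite eq_sym -ex /x' -walkS ?(ltn_trans kt tr) // wz.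
  have [ex|nx'] := eqVneq x' (linv x); last by rewrite lact_switch_other.
  rewrite ex lact_switch_inv tpermD //; last by rewrite eq_sym wz // ltnW.
  (* Crossing the redirected edge backwards from [y] would lead to [walk P t], hence [k.+1 = t];
     then [r] has two consecutive inverse letters, which reducedness excludes. *)
  apply/eqP => yk; have wSk : walk P k.+1 = walk P t.
    rewrite walkS ?(ltn_trans kt tr) // -/x' ex -yk /y -wt walkS // -/x.
    by rewrite -{2}[x]linvK lactK.
  have ekt := w_inj _ _ kt (leqnn _) wSk.
  have /(_ k) := sortedP (false, false) r_red.
  by rewrite ekt tr => /(_ isT); rewrite -/x -/x' ex linvK eqxx.
by split=> //; rewrite walkS // same // -/x lact_switch_same -walkS // wt tpermL.
Qed.

Lemma card_first_return t j : (t < size r)%N -> (j <= t)%N ->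
  (#|[set P | first_return t.+1 j P]| * (#|T| - t.+1) <=
     #|{: {ffun bool -> {perm T}}}|)%N.
Proof.
move=> tr jt.
pose x := nth (false, false) r t.
pose D := [set Pz : {ffun bool -> {perm T}} * T | first_return t.+1 j Pz.1 &
             Pz.2 \notin [seq walk Pz.1 k | k <- iota 0 t.+1]].
have -> : (#|[set P | first_return t.+1 j P]| * (#|T| - t.+1))%N = #|D|.
  rewrite -sum1_card -[RHS]sum1_card big_distrl /=.
  rewrite (eq_bigl (fun Pz => first_return t.+1 j Pz.1 &&
    (Pz.2 \notin [seq walk Pz.1 k | k <- iota 0 t.+1]))); last first.
    by move=> Pz; rewrite inE.
  rewrite -(pair_big_dep (fun P => first_return t.+1 j P)
    (fun P z => z \notin [seq walk P k | k <- iota 0 t.+1]) (fun _ _ => 1%N)) /=.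
  apply: eq_big => [P|P]; rewrite inE // => /andP[/card_uniqP uw _].
  rewrite mul1n sum1_card -(cardC (mem [seq walk P k | k <- iota 0 t.+1])) uw.
  by rewrite size_map size_iota addKn.
rewrite -(card_in_imset (f := fun Pz => switch Pz.1 x (walk Pz.1 j) Pz.2)).
  exact: max_card.
move=> [P z] [P' z']; rewrite !inE /= => /andP[fP zP] /andP[fP' zP'] e.
have [sP tP] := walk_switch tr jt fP zP.
have [sP' tP'] := walk_switch tr jt fP' zP'.
(* The new permutations alone show [z], the endpoint of their walk, and [walk P j], its [j]-th
   vertex; switching back then recovers [P]. *)
have ezz : z = z' by rewrite -tP -tP' e.
have ey : walk P j = walk P' j by rewrite -sP // -sP' // e.
by rewrite -(switchK P x (walk P j) z) e ezz ey switchK.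
Qed.

(** A closed walk has a first return, with at most [size r ^ 2] choices for its time and for the
    earlier vertex that it hits; each choice has probability at most [1 / (#|T| - size r)]. *)
Lemma card_closed_walk : (0 < size r)%N ->
  (#|[set P | walk P (size r) == v]| * (#|T| - size r) <=
     size r ^ 2 * #|{: {ffun bool -> {perm T}}}|)%N.
Proof.
move=> r0; set N := #|{: {ffun bool -> {perm T}}}|.
pose F (tj : 'I_(size r) * 'I_(size r)) :=
  if (tj.2 <= tj.1)%N then [set P | first_return tj.1.+1 tj.2 P] else set0.
have sub : [set P | walk P (size r) == v] \subset \bigcup_tj F tj.
  apply/subsetP => P; rewrite inE => /eqP wv.
  have ex : exists t, (t < size r)%N &&
      [exists j : 'I_t.+1, walk P t.+1 == walk P j].
    exists (size r).-1; apply/andP; split; first by rewrite prednK.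
    by apply/existsP; exists ord0; rewrite /= (prednK r0) wv /walk take0.
  case: (ex_minnP ex) => t /andP[tr /existsP[j wj]] tmin.
  have jr : (j < size r)%N by apply: leq_trans (ltn_ord j) _.
  apply/bigcupP; exists (Ordinal tr, Ordinal jr) => //.
  rewrite /F /= -ltnS ltn_ord inE /first_return wj andbT.
  have tu : forall s, (s <= t.+1)%N -> uniq [seq walk P k | k <- iota 0 s].
    elim=> [//|s IH] st.
    rewrite -addn1 iotaD map_cat cat_uniq IH ?(ltnW st) //= orbF andbT add0n.
    apply/mapP => -[k]; rewrite mem_iota /= add0n => ks e.
    case: s st ks e {IH} => [//|s] st ks e.
    have := tmin s; suff -> : (s < size r)%N && [exists j0 : 'I_s.+1, walk P s.+1 == walk P j0].
      by move=> /(_ isT); lia.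
    apply/andP; split; first by lia.
    by apply/existsP; exists (Ordinal ks); rewrite e.
  exact: tu.
have FN tj : (#|F tj| * (#|T| - size r) <= N)%N.
  rewrite /F; case: ifP => [jt|_]; last by rewrite cards0.
  apply: leq_trans _ (card_first_return (ltn_ord tj.1) jt).
  by rewrite leq_mul2l leq_sub2l ?orbT.
apply: leq_trans (_ : (\sum_tj #|F tj|) * (#|T| - size r) <= _)%N.
  rewrite leq_mul2r; apply/orP; right; apply: leq_trans (subset_leq_card sub) _.
  elim/big_rec2: _ => [|tj k A _ IH]; first by rewrite cards0.
  by apply: leq_trans (leq_card_setU _ _) _; rewrite leq_add2l.
rewrite big_distrl /=; apply: leq_trans (leq_sum _ (fun tj _ => FN tj)) _.
by rewrite sum_nat_const card_prod !card_ord.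
Qed.

End letter_action.

Lemma reduced_rev w : reduced w -> reduced (rev w).
Proof.
rewrite /reduced rev_sorted; congr is_true; apply: eq_sorted => x y.
by rewrite -(inj_eq (inv_inj linvK)) linvK eq_sym.
Qed.

Lemma card_word_fixes (T : finType) (v : T) w : reduced w -> w != [::] ->
  (#|[set P : {ffun bool -> {perm T}} | wact P w v == v]| * (#|T| - size w) <=
     size w ^ 2 * #|{: {ffun bool -> {perm T}}}|)%N.
Proof.
move=> rw w0; have := @card_closed_walk T v _ (reduced_rev rw).
rewrite size_rev lt0n size_eq0 => /(_ w0).
have -> // : [set P | walk v (rev w) P (size w) == v] =
             [set P : {ffun bool -> {perm T}} | wact P w v == v].
apply/setP => P; rewrite !inE /walk -(size_rev w) take_size foldl_rev.
by [].
Qed.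

(** * Counting the permutations that move a set off itself *)

Section perm_images.
Variable T : finType.

Lemma perm_imset_exists (A B : {set T}) : #|A| = #|B| ->
  exists p : {perm T}, p @: A = B.
Proof.
have [d] := ubnP #|A :\: B|; elim: d => // d IH in A *; rewrite ltnS => dA cAB.
have [/eqP AB0|[a]] := set_0Vmem (A :\: B).
  exists 1%g; rewrite (eq_imset _ (perm1 (T := T))) imset_id.
  by apply/eqP; rewrite eqEcard cAB leqnn andbT -setD_eq0.
rewrite inE => /andP[aB aA].
have [BA0|[b]] := set_0Vmem (B :\: A).
  have /eqP e : B == A by rewrite eqEcard cAB leqnn andbT -setD_eq0 BA0.
  by rewrite e aA in aB.
rewrite inE => /andP[bA bB].
have tA : tperm a b @: A = b |: (A :\ a).
  apply/setP => x; rewrite -[x](tpermK a b) mem_imset; last exact: perm_inj.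
  rewrite tpermK !inE; case: tpermP => [->|->|/eqP xa /eqP xb].
  - by rewrite (negbTE bA); case: eqP bA aA => [->|_ _ _] /=; [move=> /negbTE->|rewrite eqxx].
  - by rewrite aA eqxx.
  - by rewrite (negbTE xa) (negbTE xb).
have [||p pt] := IH (tperm a b @: A).
- apply: leq_trans dA; rewrite [X in _ < X](cardsD1 a) inE aB aA ltnS.
  apply: subset_leq_card; apply/subsetP => x; rewrite tA !inE.
  by case: (eqVneq x b) => [->|_] /=; rewrite ?bB // => /and3P[-> -> ->].
- by rewrite card_imset //; exact: perm_inj.
by exists (tperm a b * p)%g; rewrite -pt -imset_comp; apply: eq_imset => x; rewrite permM.
Qed.

(** All sets of size [#|S|] are images of [S] equally often: right multiplication by a permutation
    carrying one to the other matches the two fibres. *)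
Lemma card_perm_imset (S A : {set T}) : #|A| = #|S| ->
  #|[set p : {perm T} | p @: S == A]| * 'C(#|T|, #|S|) = #|{: {perm T}}|.
Proof.
move=> cA.
have same (B : {set T}) : #|B| = #|S| ->
    #|[set p : {perm T} | p @: S == B]| = #|[set p : {perm T} | p @: S == A]|.
  move=> cB; have [q <-] := @perm_imset_exists A B (etrans cA (esym cB)).
  rewrite -(card_imset [set p : {perm T} | p @: S == A] (mulIg q)).
  congr #|pred_of_set _|; apply/setP => p.
  rewrite -(mulgKV q p) (mem_imset _ _ (mulIg q)) !inE.
  rewrite -(inj_eq (imset_inj (@perm_inj _ q)) _ A) -imset_comp.
  by congr (_ == _); apply: eq_imset => x; rewrite permM.
have <- : \sum_(B : {set T} | #|B| == #|S|) #|[set p : {perm T} | p @: S == B]| =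
          #|{: {perm T}}|.
  rewrite -[RHS]sum1_card [RHS](partition_big (fun p : {perm T} => p @: S)
    (fun B : {set T} => #|B| == #|S|)) /=.
    by apply: eq_bigr => B _; rewrite -sum1_card; apply: eq_bigl => p; rewrite inE.
  by move=> p _; rewrite card_imset //; exact: perm_inj.
rewrite (eq_bigr (fun=> #|[set p : {perm T} | p @: S == A]|)); last first.
  by move=> B /eqP; exact: same.
by rewrite sum_nat_cond_const -card_draws mulnC; congr (_ * _); apply: eq_card => B; rewrite !inE.
Qed.

Lemma card_perm_disjoint (S : {set T}) :
  #|[set p : {perm T} | [disjoint S & p @: S]]| * 'C(#|T|, #|S|) =
  'C(#|T| - #|S|, #|S|) * #|{: {perm T}}|.
Proof.
have -> : #|[set p : {perm T} | [disjoint S & p @: S]]| =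
   \sum_(A : {set T} | (A \subset ~: S) && (#|A| == #|S|))
      #|[set p : {perm T} | p @: S == A]|.
  rewrite -[LHS]sum1_card [LHS](partition_big (fun p : {perm T} => p @: S)
    (fun A : {set T} => (A \subset ~: S) && (#|A| == #|S|))) /=.
    apply: eq_bigr => A /andP[AS _]; rewrite -sum1_card; apply: eq_bigl => p.
    rewrite !inE; case: eqP => [pS|_]; last by rewrite andbF.
    by rewrite pS disjoint_sym disjoints_subset AS.
  move=> p; rewrite inE disjoint_sym disjoints_subset => ->.
  by rewrite /= card_imset //; exact: perm_inj.
rewrite big_distrl /=.
rewrite (eq_bigr (fun=> #|{: {perm T}}|)); last first.
  by move=> A /andP[_ /eqP]; exact: card_perm_imset.
have -> : #|T| - #|S| = #|~: S| by rewrite -(cardsC S) addKn.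
by rewrite sum_nat_cond_const -cards_draws cardsE.
Qed.

Definition indep (P : {ffun bool -> {perm T}}) (S : {set T}) :=
  [forall s, [disjoint S & P s @: S]].

Lemma card_indep (S : {set T}) :
  #|[set P | indep P S]| * 'C(#|T|, #|S|) ^ 2 =
  'C(#|T| - #|S|, #|S|) ^ 2 * #|{: {ffun bool -> {perm T}}}|.
Proof.
have -> : #|[set P | indep P S]| =
          #|[set p : {perm T} | [disjoint S & p @: S]]| ^ 2.
  have <- : #|{: bool}| = 2 by rewrite card_bool.
  rewrite -card_ffun_on; apply: eq_card => P; rewrite inE.
  by apply/forallP/ffun_onP => H s; have := H s; rewrite ?inE.
by rewrite -expnMn card_perm_disjoint expnMn card_ffun card_bool.
Qed.

End perm_images.

Lemma indep_subset (T : finType) P (A B : {set T}) :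
  A \subset B -> indep P B -> indep P A.
Proof.
move=> AB /forallP H; apply/forallP => s.
exact: disjointWl AB (disjointWr (imsetS _ AB) (H s)).
Qed.

Lemma leq_expl (m n e : nat) : m <= n -> m ^ e <= n ^ e.
Proof. by case: e => [|e] mn; rewrite ?expn0 ?leq_exp2r. Qed.

(** Choosing [k] elements in each of [m] blocks is one way to choose [m * k] elements; this is a
    single term of Vandermonde's identity at each step. *)
Lemma bin_pow_le (n k m : nat) : 'C(n, k) ^ m <= 'C(m * n, m * k).
Proof.
elim: m => [|m IH]; first by rewrite expn0 !mul0n bin0.
rewrite expnS !mulSn -binomial.Vandermonde.
rewrite (bigD1 (inord k : 'I_(k + m * k).+1)) //= inordK ?ltnS ?leq_addr //.
by rewrite addKn (leq_trans _ (leq_addr _ _)) // leq_mul2l IH orbT.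
Qed.

(* From [(4 + 1)^(11 m)] one gets ['C(11 m, 2 m) <= (5^11 / 4^9)^m], and
   [(5^11 / 4^9)^2 < 187^2 < 'C(20, 9) / 4]. *)
Lemma bin_9_20 m : 'C(11 * m, 9 * m) ^ 2 * 4 ^ m <= 'C(20 * m, 9 * m).
Proof.
have -> : 'C(11 * m, 9 * m) = 'C(11 * m, 2 * m).
  by rewrite -bin_sub; [congr 'C(_, _); lia|lia].
have le5 : 'C(11 * m, 2 * m) <= 187 ^ m.
  rewrite -(@leq_pmul2r (4 ^ (9 * m))) ?expn_gt0 //.
  apply: (@leq_trans (5 ^ (11 * m))).
    have -> : 5 = 4 + 1 by [].
    rewrite expnDn (bigD1 (inord (2 * m) : 'I_(11 * m).+1)) //=.
    rewrite inordK; last by rewrite ltnS; lia.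
    have -> : 11 * m - 2 * m = 9 * m by lia.
    by rewrite exp1n muln1 leq_addr.
  by rewrite !expnM -expnMn; apply: leq_expl; lia.
apply: leq_trans (_ : 'C(20, 9) ^ m <= _); last first.
  by rewrite ![_ * m]mulnC bin_pow_le.
apply: leq_trans (leq_mul (leq_mul le5 le5) (leqnn _)) _.
rewrite -!expnMn; apply: leq_expl; by vm_compute.
Qed.

(** * Union bound over pairs of permutations *)

Section random_permutations.
Variables (m l q : nat) (L : seq (seq letter)).
Let n := 20 * m.
Local Notation T := 'I_n.
Local Notation A := #|{: {ffun bool -> {perm T}}}|.

Let fixes (P : {ffun bool -> {perm T}}) w := #|[set v | wact P w v == v]|.

Lemma card_large_indep : 0 < m ->
  4 * #|[set P : {ffun bool -> {perm T}} |
          [exists S : {set T}, (#|S| == 9 * m) && indep P S]]| <= A.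
Proof.
move=> m0; set bad := [set P | _].
have sub : bad \subset \bigcup_(S : {set T} | #|S| == 9 * m) [set P | indep P S].
  apply/subsetP => P; rewrite inE => /existsP[S /andP[cS iS]].
  by apply/bigcupP; exists S; rewrite ?inE.
have C0 : 0 < 'C(n, 9 * m) by rewrite bin_gt0 /n; lia.
have c0 : 0 < 'C(n - 9 * m, 9 * m) by rewrite bin_gt0 /n; lia.
(* First moment: there are ['C(n, 9 * m)] sets, each independent with probability [('C(n - 9 * m, 9
   * m) / 'C(n, 9 * m)) ^ 2]. *)
have le : #|bad| * 'C(n, 9 * m) <= 'C(n - 9 * m, 9 * m) ^ 2 * A.
  rewrite -(@leq_pmul2r 'C(n, 9 * m)) // -mulnA mulnn.
  apply: (@leq_trans ((\sum_(S : {set T} | #|S| == 9 * m) #|[set P | indep P S]|)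
    * 'C(n, 9 * m) ^ 2)).
    rewrite leq_mul2r; apply/orP; right; apply: leq_trans (subset_leq_card sub) _.
    elim/big_rec2: _ => [|S k B _ IH]; first by rewrite cards0.
    by apply: leq_trans (leq_card_setU _ _) _; rewrite leq_add2l.
  rewrite big_distrl /= (eq_bigr (fun=> 'C(n - 9 * m, 9 * m) ^ 2 * A)); last first.
    by move=> S /eqP cS; have := card_indep S; rewrite cS card_ord.
  have e : #|[set S : {set T} | #|S| == 9 * m]| = 'C(n, 9 * m).
    by rewrite card_draws card_ord.
  by rewrite sum_nat_cond_const -e cardsE mulnC.
have e4 : 4 <= 4 ^ m by rewrite -[4 in X in X <= _]expn1 leq_exp2l.
rewrite -(@leq_pmul2r ('C(n - 9 * m, 9 * m) ^ 2)) ?expn_gt0 ?c0 //.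
apply: leq_trans (_ : #|bad| * ('C(n - 9 * m, 9 * m) ^ 2 * 4 ^ m) <= _).
  by rewrite [4 * _]mulnC -mulnA leq_mul2l [4 * _]mulnC leq_mul2l e4 !orbT.
rewrite [X in _ <= X]mulnC; apply: leq_trans le; rewrite leq_mul2l.
have := bin_9_20 m; have -> : n - 9 * m = 11 * m by rewrite /n; lia.
by move=> ->; rewrite orbT.
Qed.

(** Markov's inequality for the number of fixed points, whose mean is a sum over [v] of the
    probabilities in [card_word_fixes]. *)
Lemma card_many_fixes w : 0 < m -> reduced w -> w != [::] ->
  #|[set P : {ffun bool -> {perm T}} | n < q * fixes P w]| * (n - size w) <=
    q * size w ^ 2 * A.
Proof.
move=> m0 rw w0; set bad := [set P | _].
have n0 : 0 < n by rewrite /n; lia.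
have le : #|bad| * n <= q * \sum_(v : T)
    #|[set P : {ffun bool -> {perm T}} | wact P w v == v]|.
  have -> : \sum_(v : T) #|[set P : {ffun bool -> {perm T}} | wact P w v == v]| =
            \sum_(P : {ffun bool -> {perm T}}) fixes P w.
    rewrite (eq_bigr (fun v => \sum_P (wact P w v == v))); last first.
      by move=> v _; rewrite -sum1_card big_mkcond; apply: eq_bigr => P _; rewrite inE; case: eqP.
    rewrite exchange_big; apply: eq_bigr => P _.
    by rewrite /fixes -sum1_card [RHS]big_mkcond; apply: eq_bigr => v _; rewrite inE; case: eqP.
  rewrite big_distrr /= -sum_nat_const big_mkcond.
  by apply: leq_sum => P _; rewrite inE; case: ifP => // /ltnW.
rewrite -(@leq_pmul2r n) // mulnAC; apply: leq_trans (leq_mul le (leqnn _)) _.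
rewrite -mulnA big_distrl /= -!mulnA leq_mul2l; apply/orP; right.
apply: leq_trans (_ : \sum_(v : T) size w ^ 2 * A <= _).
  by apply: leq_sum => v _; have := card_word_fixes v rw w0; rewrite card_ord.
by rewrite sum_nat_const card_ord mulnC !mulnA.
Qed.

(** The lower bound on [n] gives [n - size w >= 4 * size L * (q * l ^ 2)], so each word of [L] fails
    with probability at most [1 / (4 * size L)], and some word fails with probability at most
    [1 / 4]. *)
Lemma good_permutations :
  (forall w, w \in L -> [/\ reduced w, w != [::] & size w <= l]) ->
  0 < m -> 0 < q -> l + 4 * size L * (q * l ^ 2) <= n ->
  exists P : {ffun bool -> {perm T}},
    (forall w, w \in L -> q * fixes P w <= n) /\
    (forall S, indep P S -> #|S| < 9 * m).
Proof.
move=> HL m0 q0 nl.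
pose bad1 : {set {ffun bool -> {perm T}}} :=
  [set P | [exists S : {set T}, (#|S| == 9 * m) && indep P S]].
pose bad2 : {set {ffun bool -> {perm T}}} :=
  [set P | has (fun w => n < q * fixes P w) L].
have b1 : 4 * #|bad1| <= A by apply: card_large_indep.
have A0 : 0 < A by apply/card_gt0P; exists [ffun=> 1%g].
have bw w : w \in L -> #|[set P : {ffun bool -> {perm T}} | n < q * fixes P w]| *
    (4 * size L) <= A.
  move=> wL; have [rw w0 wl] := HL w wL.
  have l0 : 0 < l by apply: leq_trans wl; rewrite lt0n size_eq0.
  have := card_many_fixes m0 rw w0; move: #|[set P | _]| => B HB.
  rewrite -(@leq_pmul2r (q * l ^ 2)) ?muln_gt0 ?q0 ?expn_gt0 ?l0 //.
  rewrite -mulnA; apply: leq_trans (_ : B * (n - size w) <= _).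
    by rewrite leq_mul2l; apply/orP; right; lia.
  apply: leq_trans HB _; rewrite mulnC leq_mul2l; apply/orP; right.
  by rewrite leq_mul2l leq_expl ?orbT.
have b2 : 4 * #|bad2| <= A.
  have sub : #|bad2| <= \sum_(w <- L) #|[set P : {ffun bool -> {perm T}} | n < q * fixes P w]|.
    rewrite /bad2; elim: (L) => [|w L' IH].
      by rewrite big_nil leqn0 cards_eq0; apply/eqP/setP => P; rewrite !inE.
    rewrite big_cons; apply: leq_trans (leq_add (leqnn _) IH).
    apply: leq_trans (leq_card_setU _ _); apply: subset_leq_card.
    by apply/subsetP => P; rewrite !inE.
  have [L0|L0] := posnP (size L).
    by move: sub; rewrite (size0nil L0) big_nil leqn0 => /eqP->.
  rewrite -(@leq_pmul2r (size L)) // [4 * _]mulnC -mulnA.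
  apply: leq_trans (leq_mul sub (leqnn _)) _; rewrite big_distrl /=.
  apply: leq_trans (_ : \sum_(w <- L) A <= _); last first.
    by rewrite big_const_seq count_predT iter_addn_0 mulnC.
  by rewrite big_seq [X in _ <= X]big_seq; apply: leq_sum => w; exact: bw.
have : bad1 :|: bad2 != [set: {ffun bool -> {perm T}}].
  apply: contraTneq A0 => e; rewrite -leqNgt.
  have := (leq_card_setU bad1 bad2).1; rewrite e cardsT.
  move: b1 b2; move: A #|bad1| #|bad2| => *; lia.
rewrite -subTset => /subsetPn[P _]; rewrite !inE negb_or => /andP[n1 n2].
exists P; split=> [w wL|S iS].
  by move: n2 => /hasPn/(_ w wL); rewrite -leqNgt.
(* The first moment treats sets of exactly [9 * m] points; a larger independent set contains one of
   these. *)
rewrite ltnNge; apply: contra n1 => cS.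
have [B BS cB] : exists2 B : {set T}, B \subset S & #|B| = 9 * m.
  exists [set x in take (9 * m) (enum S)].
    by apply/subsetP => x; rewrite inE => /mem_take; rewrite mem_enum.
  rewrite cardsE (card_uniqP _) ?take_uniq ?enum_uniq // size_take -cardE.
  by case: ltngtP cS.
by apply/existsP; exists B; rewrite cB eqxx (indep_subset BS).
Qed.

End random_permutations.

(** * A discrete Poincare-Miranda theorem *)

Local Open Scope ring_scope.

(** [bool] is the field with two elements here, so the terms for [(i, j)] and [(j, i)] cancel. *)
Lemma sum_pairs_char2 (T : finType) (H : {set T}) (G : T -> T -> bool) :
  (forall i j, G i j = G j i) ->
  \sum_(i in H) \sum_(j in H :\ i) G i j = 0.
Proof.
move=> Gsym.
have split_i i : i \in H -> \sum_(j in H :\ i) G i j =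
    \sum_(j in H | (enum_rank j < enum_rank i)%N) G i j +
    \sum_(j in H | (enum_rank i < enum_rank j)%N) G i j.
  move=> iH; rewrite (bigID (fun j => (enum_rank j < enum_rank i)%N)) /=.
  congr (_ + _); apply: eq_bigl => j; rewrite in_setD1.
    by case: eqVneq => [->|_]; rewrite ?ltnn ?andbF.
  case: eqVneq => [->|ne] /=; first by rewrite ltnn andbF.
  rewrite -leqNgt leq_eqVlt; case: eqP => //= /val_inj/enum_rank_inj e.
  by rewrite e eqxx in ne.
rewrite (eq_bigr _ split_i) big_split /=.
rewrite [X in _ + X](exchange_big_dep (fun j => j \in H)) /=; last first.
  by move=> i j _ /andP[].
rewrite -big_split big1 // => i iH /=.
set A := (X in X + _); set B := (X in _ + X).
suff -> : B = A by exact: addbb.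
rewrite /B; apply: eq_big => [j|j _]; last exact: Gsym.
by rewrite iH.
Qed.

Section cubical_cup_product.
Variables (n M : nat).
Local Notation P := {ffun 'I_n -> 'I_M.+1}.
Variable f : nat -> P -> bool.

(** Out of range, [inord] returns its default [ord0]: steps are total and commute unconditionally,
    but move up only where [v i < M]. *)
Definition step (i : 'I_n) (v : P) : P :=
  [ffun j => if j == i then inord (v i).+1 else v j].

Lemma stepC i j v : step i (step j v) = step j (step i v).
Proof.
case: (eqVneq i j) => [->//|ij]; apply/ffunP => k.
have ji : j != i by rewrite eq_sym.
rewrite !ffunE (negbTE ij) (negbTE ji).
by case: (eqVneq k i) => [->|//]; rewrite (negbTE ij).
Qed.

Lemma step_other i j (v : P) : j != i -> step i v j = v j.
Proof. by rewrite ffunE => /negbTE->. Qed.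

Lemma step_same i (v : P) : (v i < M)%N -> step i v i = (v i).+1 :> nat.
Proof. by move=> viM; rewrite ffunE eqxx inordK. Qed.

(* The cubical cup product [df_k \cup ... \cup df_(k+m-1)] modulo 2, on the
   unit cube with origin [v] and edge directions [H]. *)
Fixpoint cup (m k : nat) (v : P) (H : {set 'I_n}) : bool :=
  if m is m'.+1 then
    \sum_(i in H) (f k v + f k (step i v)) * cup m' k.+1 (step i v) (H :\ i)
  else 1.

(** The Leibniz rule: if [c] is closed, then [df_k \cup c] is the coboundary of [f_k c], a sum over
    pairs of opposite facets. *)
Lemma cup_coboundary m k v (H : {set 'I_n}) :
  \sum_(i in H) (cup m k.+1 v (H :\ i) + cup m k.+1 (step i v) (H :\ i)) = 0 ->
  cup m.+1 k v H =
  \sum_(i in H) (f k v * cup m k.+1 v (H :\ i) +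
                 f k (step i v) * cup m k.+1 (step i v) (H :\ i)).
Proof.
move=> cl; have := congr1 ( *%R (f k v)) cl; rewrite mulr0 mulr_sumr => cl'.
rewrite -[RHS]addr0 -[X in _ = _ + X]cl' -big_split /=.
apply: eq_bigr => i _.
by case: (f k v) (f k (step i v)) (cup _ _ v _) (cup _ _ _ _) => -[] [] [].
Qed.

(** By [cup_coboundary] and induction the product is a coboundary, so this is [d d = 0]: each face
    of codimension 2 arises from two orders of its two missing directions. *)
Lemma cup_closed m k v (H : {set 'I_n}) : #|H| = m.+1 ->
  \sum_(i in H) (cup m k v (H :\ i) + cup m k (step i v) (H :\ i)) = 0.
Proof.
elim: m k v H => [|m IH] k v H cH; first by rewrite big1.
have cHi i : i \in H -> #|H :\ i| = m.+1.
  by move=> iH; apply/eqP; rewrite -eqSS -cH [in X in _ == X](cardsD1 i) iH.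
pose e w (K : {set 'I_n}) : bool := f k w * cup m k.+1 w K.
pose G i j : bool := e v (H :\ i :\ j) + e (step j v) (H :\ i :\ j) +
  e (step i v) (H :\ i :\ j) + e (step j (step i v)) (H :\ i :\ j).
rewrite -[RHS](@sum_pairs_char2 _ H G); last first.
  move=> i j; rewrite /G stepC.
  have -> : H :\ i :\ j = H :\ j :\ i.
    by apply/setP => x; rewrite !inE; case: (x == i); case: (x == j).
  by congr (_ + _); rewrite -!addrA; congr (_ + _); rewrite addrC.
apply: eq_bigr => i iH.
rewrite !cup_coboundary; last 2 first.
- by apply: IH; apply: cHi.
- by apply: IH; apply: cHi.
by rewrite -big_split /=; apply: eq_bigr => j _; rewrite /G /e !addrA.
Qed.

(** The factor [df_l] vanishes on a face where [f l] is constant. *)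
Lemma cup_face m k l (v : P) (H : {set 'I_n}) (i : 'I_n) (c : nat) (x : bool) :
  (forall w : P, w i = c :> nat -> f l w = x) ->
  (k <= l < k + m)%N -> v i = c :> nat -> i \notin H -> cup m k v H = 0.
Proof.
move=> fl; elim: m k v H => [|m IH] k v H; first by rewrite addn0; case: ltngtP.
move=> klm vi iH; rewrite /= big1 // => j jH.
have ji : i != j by apply: contraNneq iH => ->.
have sji : step j v i = c :> nat by rewrite step_other.
case: (eqVneq k l) => [kl|kl].
  by rewrite kl !fl // -[X in X * _]/(addb x x) addbb mul0r.
rewrite IH ?mulr0 //; last by rewrite !inE (negbTE iH) andbF.
by rewrite addSnnS ltn_neqAle kl.
Qed.

(** A nonzero product has a nonzero term, that is, a monotone edge path through the cube whose
    successive edges each change the corresponding [f l]. *)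
Lemma cup_neq0 m k l (v : P) (H : {set 'I_n}) : cup m k v H ->
  (k <= l < k + m)%N -> (forall j, j \in H -> (v j < M)%N) ->
  exists w w' : P,
    (forall j, v j <= w j <= v j + (j \in H) /\
               v j <= w' j <= v j + (j \in H))%N /\ f l w != f l w'.
Proof.
elim: m k v H => [|m IH] k v H; first by rewrite addn0; case: ltngtP.
move=> cn klm vM.
have [i /andP[iH]] : exists i, (i \in H) &&
    ((f k v + f k (step i v)) * cup m k.+1 (step i v) (H :\ i)).
  apply/existsP; apply: contraT; rewrite negb_exists => /forallP no.
  move: cn; rewrite /= big1 // => i iH.
  by have := no i; rewrite iH /= => /negbTE.
move=> /andP[df cn'].
have vi := vM _ iH.
case: (eqVneq k l) => [kl|kl].
  exists v, (step i v); rewrite -kl; split.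
    move=> j; split; first by rewrite leqnn leq_addr.
    case: (eqVneq j i) => [->|ji].
      by rewrite step_same // leqnSn iH addn1 leqnn.
    by rewrite step_other // leqnn leq_addr.
  by move: df; case: (f k v); case: (f k _).
have [|j jHi|w [w' [ww' fw]]] := IH _ _ _ cn'.
- by rewrite addSnnS ltn_neqAle kl.
- move: jHi; rewrite !inE => /andP[ji jH].
  by rewrite step_other //; apply: vM.
exists w, w'; split=> // j.
have := ww' j; rewrite !inE.
case: (eqVneq j i) => [->|ji] /=.
  by rewrite step_same // iH; lia.
by rewrite step_other.
Qed.

Definition directions_from k : {set 'I_n} := [set j : 'I_n | (k <= j)%N].

(** The lower corners of the unit cubes that tile the face of the grid on which the first [k]
    coordinates vanish. *)
Definition slab k (p : P) :=
  [forall j : 'I_n, if (j < k)%N then p j == 0%N :> nat else (p j < M)%N].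

(** An inner facet orthogonal to direction [i] belongs to two cubes and cancels modulo 2; the two
    outer faces remain. *)
Lemma telescope_coordinate (g : P -> bool) (i : 'I_n) k : (0 < M)%N ->
  (k <= i)%N ->
  \sum_(p | slab k p) (g p + g (step i p)) =
  \sum_(p | slab k p && (p i == 0%N :> nat)) g p +
  \sum_(p : P | [forall j : 'I_n, if (j < k)%N then p j == 0%N :> nat
                     else if j == i then p j == M :> nat else (p j < M)%N]) g p.
Proof.
move=> M0 ki; rewrite big_split /=.
pose slab' (p : P) := [forall j : 'I_n, if (j < k)%N then p j == 0%N :> nat
   else if j == i then (0 < p j)%N else (p j < M)%N].
have -> : \sum_(p | slab k p) g (step i p) = \sum_(p | slab' p) g p.
  pose back (p : P) : P := [ffun j => if j == i then inord (p i).-1 else p j].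
  have backi (p : P) : back p i = (p i).-1 :> nat.
    rewrite ffunE eqxx inordK //.
    by apply: leq_trans (ltn_ord (p i)); rewrite ltnS leq_pred.
  have backo (p : P) j : j != i -> back p j = p j.
    by move=> /negbTE ji; rewrite ffunE ji.
  rewrite [RHS](reindex_onto (step i) back) /=.
    apply: eq_bigl => p; apply/idP/andP => [/forallP sp|[/forallP sp /eqP bp]].
      have piM : (p i < M)%N by have := sp i; rewrite ltnNge ki.
      split.
        apply/forallP => j; have := sp j; case: ifP => jk.
          by rewrite step_other //; apply: contraTneq jk => ->; rewrite -leqNgt.
        by case: eqVneq => [->|ji] pj; [rewrite step_same|rewrite step_other].
      apply/eqP/ffunP => j; apply: val_inj => /=.
      case: (eqVneq j i) => [->|ji]; first by rewrite backi step_same.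
      by rewrite backo // step_other.
    apply/forallP => j; have := sp j; case: ifP => jk.
      by rewrite step_other //; apply: contraTneq jk => ->; rewrite -leqNgt.
    case: eqVneq => [->|ji] pj; last by rewrite step_other in pj.
    have := congr1 (fun q : P => val (q i)) bp; rewrite /= backi => <-.
    by rewrite prednK // -ltnS.
  move=> p /forallP sp; have := sp i; rewrite ltnNge ki eqxx /= => p0.
  apply/ffunP => j; apply: val_inj => /=.
  case: (eqVneq j i) => [->|ji]; last by rewrite step_other // backo.
  rewrite step_same backi ?prednK //; exact: (ltn_ord (p i)).
rewrite (bigID (fun p : P => p i == 0%N :> nat)) /=.
rewrite [X in _ + X](bigID (fun p : P => (p i < M)%N)) /= -!addrA; congr (_ + _).
rewrite addrA [X in X + _ + _](eq_bigl (fun p => slab' p && (p i < M)%N)).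
  rewrite -[X in X + _ = _]/(addb _ _) addbb add0r; apply: eq_bigl => p.
  apply/andP/forallP => [[/forallP sp piM] j|sp].
    have := sp j; case: ifP => // jk; case: eqVneq => [->|] // _.
    by move: (ltn_ord (p i)) piM; lia.
  have := sp i; rewrite ltnNge ki eqxx /= => /eqP piM.
  rewrite piM ltnn; split=> //; apply/forallP => j; have := sp j.
  by case: ifP => // jk; case: eqVneq => [->|]; rewrite // piM.
move=> p; apply/andP/andP => -[/forallP sp pi].
  have := sp i; rewrite ltnNge ki /= => ->; split=> //.
  apply/forallP => j; have := sp j; case: ifP => // jk.
  by case: eqVneq => [->|//]; rewrite lt0n.
have := sp i; rewrite ltnNge ki eqxx /= -lt0n => ->; split=> //.
apply/forallP => j; have := sp j; case: ifP => // jk.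
by case: eqVneq => [->|//].
Qed.

(** Stokes' formula reduces the sum to the outer faces. The face [p k = 0], where [f k = 1], yields
    the same sum in one dimension less; on [p k = M] the factor [f k] is [0]; and on the faces of a
    later direction [i] the factor [df_i] vanishes. *)
Lemma sum_cup_slab : (0 < M)%N ->
  (forall (k : 'I_n) (p : P), p k = 0%N :> nat -> f k p) ->
  (forall (k : 'I_n) (p : P), p k = M :> nat -> f k p = false) ->
  forall m k, (k + m = n)%N ->
  \sum_(p | slab k p) cup m k p (directions_from k) = 1.
Proof.
move=> M0 f0 fM; elim=> [|m IH] k km.
  rewrite /= (big_pred1 [ffun=> ord0]) // => p; apply/forallP/eqP => [sp|-> j].
    apply/ffunP => j; apply: val_inj; rewrite ffunE /=.
    by have := sp j; rewrite ifT => [/eqP//|]; have := ltn_ord j; lia.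
  by rewrite ifT ?ffunE //; have := ltn_ord j; lia.
have kn : (k < n)%N by lia.
pose ko := Ordinal kn.
have cD : #|directions_from k| = m.+1.
  rewrite -sum1_card (eq_bigl (fun j : 'I_n => (k <= j)%N)); last first.
    by move=> j; rewrite inE.
  by rewrite -(big_geq_mkord k n xpredT (fun=> 1%N)) sum_nat_const_nat; lia.
transitivity (\sum_(i in directions_from k) \sum_(p | slab k p)
   (f k p * cup m k.+1 p (directions_from k :\ i) +
    f k (step i p) * cup m k.+1 (step i p) (directions_from k :\ i))).
  rewrite [RHS]exchange_big; apply: eq_bigr => p _.
  by rewrite cup_coboundary //; exact: cup_closed.
rewrite (bigD1 ko) ?inE //= [X in _ + X]big1 ?addr0.
  rewrite (@telescope_coordinate
    (fun p => f k p * cup m k.+1 p (directions_from k :\ ko))) //.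
  rewrite [X in _ + X]big1 ?addr0.
    rewrite -(IH k.+1); last by lia.
    have -> : directions_from k :\ ko = directions_from k.+1.
      apply/setP => j; rewrite !inE -val_eqE /=.
      by rewrite [RHS]ltn_neqAle eq_sym.
    rewrite (eq_bigl (slab k.+1)).
      apply: eq_bigr => p /forallP sp; rewrite (f0 ko) ?mul1r //=.
      by have := sp ko; rewrite /= ltnSn => /eqP.
    move=> p; apply/andP/forallP => [[/forallP sp p0] j|sp].
      have := sp j; rewrite ltnS; case: (ltngtP (val j) k) => // jk _.
      by have -> : j = ko by apply: val_inj.
    have := sp ko; rewrite /= ltnSn => pk; split=> //.
    apply/forallP => j; have := sp j.
    rewrite ltnS; case: (ltngtP (val j) k) => // jk /eqP pj.
    by rewrite pj.
  move=> p /forallP sp; rewrite (fM ko) ?mul0r //=.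
  by have := sp ko; rewrite /= ltnn eqxx => /eqP.
move=> i /andP[]; rewrite inE => ki iko.
have ik : (k < i)%N by move: iko; rewrite -val_eqE /=; lia.
rewrite (@telescope_coordinate
    (fun p => f k p * cup m k.+1 p (directions_from k :\ i))) //.
have il : (k.+1 <= i < k.+1 + m)%N by rewrite ik addSnnS km ltn_ord.
rewrite !big1 ?addr0 // => p.
  move=> /forallP sp; rewrite (@cup_face _ _ i _ _ i M false) ?mulr0 ?inE ?eqxx //.
    by move=> w wi; apply: fM.
  by have := sp i; rewrite ltnNge ki eqxx /= => /eqP.
move=> /andP[_ /eqP pi0].
by rewrite (@cup_face _ _ i _ _ i 0 true) ?mulr0 ?inE ?eqxx // => w wi; apply: f0.
Qed.

End cubical_cup_product.

Lemma discrete_miranda n M (f : 'I_n -> {ffun 'I_n -> 'I_M.+1} -> bool) :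
  (0 < M)%N ->
  (forall k (p : {ffun 'I_n -> 'I_M.+1}), p k = 0%N :> nat -> f k p) ->
  (forall k (p : {ffun 'I_n -> 'I_M.+1}), p k = M :> nat -> f k p = false) ->
  exists p : {ffun 'I_n -> 'I_M.+1}, forall k, exists q q' : {ffun 'I_n -> 'I_M.+1},
   [/\ forall j, (p j <= q j <= (p j).+1)%N,
       forall j, (p j <= q' j <= (p j).+1)%N, f k q & ~~ f k q'].
Proof.
move=> M0 f0 fM.
pose g k p := if insub k is Some i then f i p else false.
have gE (k : 'I_n) : g k = f k by rewrite /g valK.
(* The products add up to [1], so one of the unit cubes has a nonzero product, and there every [f k]
   takes both values. *)
have [p /andP[/forallP sp cp]] : exists p,
    slab 0 p && cup g n 0 p (directions_from n 0).
  apply/existsP; apply: contraT; rewrite negb_exists => /forallP no.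
  have := @sum_cup_slab n M g M0 _ _ n 0 (add0n n).
  rewrite big1 => [|p pP]; last by have := no p; rewrite pP /= => /negbTE.
  by move=> H; suff: 0 = 1 :> bool by []; apply: H => k p pk; rewrite gE; auto.
exists p => k.
have [|j _|w [w' [ww' fw]]] := cup_neq0 (l := k) cp _ _.
- by rewrite leq0n add0n ltn_ord.
- exact: sp j.
have bd j : (p j <= w j <= (p j).+1)%N /\ (p j <= w' j <= (p j).+1)%N.
  by have := ww' j; rewrite inE /=; lia.
move: fw; rewrite gE; case e: (f k w); case e': (f k w') => // _.
  by exists w, w'; rewrite e e'; split=> // j; have [] := bd j.
by exists w', w; rewrite e e'; split=> // j; have [] := bd j.
Qed.

(** * An approximate Sperner theorem on the grid *)

Section near_colors.
Variables (n M : nat) (C : eqType).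
Local Notation P := {ffun 'I_n -> 'I_M.+1}.
Variable col : P -> C.

Definition grid_dist (p q : P) : nat :=
  \max_(j < n) ((p j - q j) + (q j - p j))%N.

Definition proximity (c : C) (p : P) : nat :=
  \max_(q | col q == c) (5 - grid_dist p q)%N.

Lemma grid_distP (p q : P) r :
  (grid_dist p q <= r)%N -> forall j, (p j <= q j + r /\ q j <= p j + r)%N.
Proof. by move=> /bigmax_leqP H j; have := H j isT; lia. Qed.

Lemma grid_dist_triangle (p q r : P) :
  (grid_dist p r <= grid_dist p q + grid_dist q r)%N.
Proof.
apply/bigmax_leqP => j _.
have := grid_distP (leqnn (grid_dist p q)) j.
have := grid_distP (leqnn (grid_dist q r)) j.
lia.
Qed.

Lemma proximity_lipschitz c (p q : P) :
  (proximity c p <= proximity c q + grid_dist p q)%N.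
Proof.
apply/bigmax_leqP => r cr.
have := grid_dist_triangle q p r.
have := @leq_bigmax_cond _ (fun r => col r == c) (fun r => 5 - grid_dist q r)%N r cr.
rewrite -/(proximity c q) /grid_dist.
have -> : (\max_(j < n) (q j - p j + (p j - q j)) =
           \max_(j < n) (p j - q j + (q j - p j)))%N.
  by apply: eq_bigr => j _; rewrite addnC.
lia.
Qed.

Lemma proximity_gt0 c (p : P) : (0 < proximity c p)%N ->
  exists2 q, col q = c & (grid_dist p q < 5)%N.
Proof.
rewrite lt0n => pn0; have : [exists q, (col q == c) && (grid_dist p q < 5)%N].
  apply: contra_neqT pn0; rewrite negb_exists => /forallP no.
  by apply: big1 => q cq; have := no q; rewrite cq -leqNgt => /eqP.
by move=> /existsP[q /andP[/eqP cq d]]; exists q.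
Qed.

Lemma proximity_self (p : P) : proximity (col p) p = 5%N.
Proof.
apply/eqP; rewrite eqn_leq; apply/andP; split.
  by apply/bigmax_leqP => q _; rewrite leq_subr.
have := @leq_bigmax_cond _ (fun r => col r == col p) (fun r => 5 - grid_dist p r)%N p (eqxx _).
rewrite -/(proximity _ _); suff -> : grid_dist p p = 0%N by [].
by apply: big1 => j _; rewrite subnn.
Qed.

End near_colors.

(* Miranda's theorem is applied to the differences of the proximities of
   [Some k] and [None]: where all of them are small, all colors are close.
   The color [Some k] plays the role of the [k]-th vertex of the simplex, and
   [None] that of the remaining one. *)
Lemma approximate_sperner n M
    (col : {ffun 'I_n -> 'I_M.+1} -> option 'I_n) : (0 < M)%N ->
  (forall k (p : {ffun 'I_n -> 'I_M.+1}), (M < p k + 5)%N -> col p != Some k) ->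
  (forall k (p : {ffun 'I_n -> 'I_M.+1}), (p k < 5)%N -> col p != None) ->
  exists p : {ffun 'I_n -> 'I_M.+1}, forall c, exists2 q, col q = c &
    forall j, (p j < q j + 5 /\ q j < p j + 5)%N.
Proof.
move=> M0 colS colN.
pose u := proximity col.
(* The outer faces get the values that Miranda's theorem prescribes. They remain consistent with the
   weak comparison, since the boundary conditions on [col] make the smaller proximity zero there. *)
pose f (k : 'I_n) (p : {ffun 'I_n -> 'I_M.+1}) :=
  (p k == 0%N :> nat) || (p k != M :> nat) && (u None p < u (Some k) p)%N.
have [k p /eqP pk|k p pk|p Hp] := discrete_miranda (f := f) M0.
- by rewrite /f pk.
- by rewrite /f pk eqxx /= orbF; apply/eqP; lia.
exists p; suff u_gt0 c : (0 < u c p)%N.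
  move=> c; have [q cq] := proximity_gt0 (u_gt0 c).
  rewrite -ltnS => /grid_distP Hq; exists q => // j.
  by have := Hq j; lia.
have dist1 (q : {ffun 'I_n -> 'I_M.+1}) :
    (forall j, (p j <= q j <= (p j).+1)%N) -> (grid_dist p q <= 1)%N /\ (grid_dist q p <= 1)%N.
  by move=> pq; split; apply/bigmax_leqP => j _; have := pq j; lia.
have key k : (u None p <= u (Some k) p + 2 /\ u (Some k) p <= u None p + 2)%N.
  have [q [q' [/dist1[d1 d2] /dist1[d3 d4] fq fq']]] := Hp k.
  have : (u None q <= u (Some k) q)%N.
    move: fq; rewrite /f => /orP[/eqP qk|/andP[_ /ltnW //]].
    have [->//|/proximity_gt0[r cr]] := posnP (u None q).
    rewrite -ltnS => /grid_distP/(_ k) dqr; have := colN k r.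
    by rewrite cr eqxx; lia.
  have : (u (Some k) q' <= u None q')%N.
    move: fq'; rewrite /f negb_or negb_and negbK -leqNgt => /andP[_].
    move=> /orP[/eqP qk|//].
    have [->//|/proximity_gt0[r cr]] := posnP (u (Some k) q').
    rewrite -ltnS => /grid_distP/(_ k) dqr; have := colS k r.
    by rewrite cr eqxx; lia.
  have := proximity_lipschitz col None p q.
  have := proximity_lipschitz col (Some k) q p.
  have := proximity_lipschitz col None q' p.
  have := proximity_lipschitz col (Some k) p q'.
  rewrite -/u; move: d1 d2 d3 d4.
  move: (u None p) (u None q) (u None q') (u (Some k) p) (u (Some k) q) => a b b2 a2 b3.
  move: (u (Some k) q') (grid_dist p q) (grid_dist q p) => d e h.
  move: (grid_dist p q') (grid_dist q' p) => i i' j.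
  lia.
(* This fixes the constant [5]: through [None], any two proximities at [p] differ by at most
   [2 + 2], and that of the color of [p] is [5], so all are positive. *)
have := proximity_self col p; rewrite -/u.
case: (col p) => [k|] uk; case: c => [k'|].
- move: (key k) (key k'); move: (u None p) (u (Some k') p) => a b.
  by rewrite uk; lia.
- by move: (key k); rewrite uk; move: (u None p) => a; lia.
- by move: (key k'); rewrite uk; move: (u _ p) => a; lia.
by rewrite uk.
Qed.

(** * Pointwise topology and the Lebesgue covering theorem *)

From mathcomp Require Import all_classical all_reals all_analysis.
From mathcomp Require Import finmap lra.

Import numFieldNormedType.Exports.

Local Open Scope classical_set_scope.

Lemma cvg_ptws (I : eqType) (X : topologicalType)
    (F : set_system {ptws I -> X}) (f : {ptws I -> X}) : Filter F ->
  (forall i, (fun g : {ptws I -> X} => g i) @ F --> f i) -> F --> f.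
Proof.
move=> FF Ff; apply/cvg_sup => i; apply/cvg_image.
  apply/seteqP; split=> [//|y _].
  exists (@dfwith I (fun=> X) f i y) => //=.
  exact: (@dfwithin I (fun=> X) f i y).
move=> A /Ff FA; exists ((fun g : {ptws I -> X} => g i) @^-1` A) => //.
rewrite image_preimage //; apply/seteqP; split=> [//|y _].
exists (@dfwith I (fun=> X) f i y) => //=.
exact: (@dfwithin I (fun=> X) f i y).
Qed.

Lemma continuous_into_ptws (I : eqType) (X Y : topologicalType)
    (f : Y -> {ptws I -> X}) :
  (forall i, continuous (fun y => f y i)) -> continuous f.
Proof. by move=> cf y; apply: cvg_ptws => i; exact: cf. Qed.

Lemma continuous_eval (I : eqType) (X : topologicalType) (i : I) :
  continuous (fun f : {ptws I -> X} => f i).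
Proof. exact: (@proj_continuous I (fun=> X) i). Qed.

Lemma continuous_val (X : topologicalType) (A : set X) :
  continuous (\val : set_type A -> X).
Proof. exact: initial_continuous. Qed.

Section boxes.
Context {R : realType} {I : choiceType}.

Definition box (W : seq I) (e : R) (x : I -> R) : set {ptws I -> R} :=
  [set y | forall i, i \in W -> `|x i - y i| < e].

Lemma nbhs_box (x : {ptws I -> R}) W e : 0 < e -> nbhs x (box W e x).
Proof.
move=> e0; elim: W => [|i W IH].
  by apply: filterS filterT => y _ i; rewrite in_nil.
have : nbhs x [set y : {ptws I -> R} | `|x i - y i| < e].
  apply: (@continuous_eval I R i x [set r | `|x i - r| < e]).
  by apply: (@nbhsx_ballx _ _ (x i) e).
move=> /(filterI IH); apply: filterS => y [yW yi] j.
by rewrite inE => /orP[/eqP->//|/yW].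
Qed.

Lemma nbhs_ptwsP (x : {ptws I -> R}) (A : set {ptws I -> R}) : nbhs x A ->
  exists W, exists2 e, 0 < e & box W e x `<=` A.
Proof.
pose F : set_system {ptws I -> R} :=
  filter_from [set We : seq I * R | 0 < We.2] (fun We => box We.1 We.2 x).
have FF : Filter F.
  apply: filter_from_filter; first by exists ([::], 1) => /=; exact: ltr01.
  move=> [W e] [W' e'] /= e0 e'0; exists (W ++ W', Num.min e e') => /=.
    by rewrite lt_min e0.
  move=> y yb; split=> i iW.
    by apply: lt_le_trans (yb i _) _; rewrite ?mem_cat ?iW // ge_min lexx.
  by apply: lt_le_trans (yb i _) _; rewrite ?mem_cat ?iW ?orbT // ge_min lexx orbT.
have Fx : F --> x.
  apply: cvg_ptws => i B /nbhs_ballP[e /= e0 eB].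
  exists ([:: i], e) => //= y yb; apply: eB.
  by rewrite /ball /=; apply: yb; rewrite inE.
by move=> /Fx[[W e] /= e0 bA]; exists W, e.
Qed.

(** In place of a metric, the Lebesgue number consists of finitely many coordinates and a radius.
    The filter [F] of ever finer such pairs lets compactness, in its near-covering form, choose one
    for all points. *)
Lemma ptws_lebesgue_number (K : set {ptws I -> R}) (J : Type)
    (B : J -> set {ptws I -> R}) : compact K -> (forall j, open (B j)) ->
  (forall x, K x -> exists j, B j x) ->
  exists W, exists2 e, 0 < e & forall x, K x -> exists j, box W e x `<=` B j.
Proof.
move=> /compact_near_coveringP cK oB KB.
pose F : set_system (seq I * R) :=
  filter_from [set We : seq I * R | 0 < We.2]
   (fun We => [set We' | {subset We.1 <= We'.1} /\ 0 < We'.2 <= We.2]).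
have FF : Filter F.
  apply: filter_from_filter; first by exists ([::], 1) => /=; exact: ltr01.
  move=> [W e] [W' e'] /= e0 e'0; exists (W ++ W', Num.min e e') => /=.
    by rewrite lt_min e0.
  move=> [U d] /= [WU /andP[d0]]; rewrite le_min => /andP[de de'].
  by split; split=> [i iW|]; rewrite ?d0 //; apply: WU; rewrite mem_cat iW ?orbT.
have : \forall We \near F, K `<=` [set x | exists j, box We.1 We.2 x `<=` B j].
  apply: cK => x /KB[j Bx].
  have [W [e e0 bW]] := nbhs_ptwsP (open_nbhs_nbhs (conj (oB j) Bx)).
  exists (box W (e / 2) x, [set We' | {subset W <= We'.1} /\ 0 < We'.2 <= e / 2]).
    split=> /=; first by apply: nbhs_box; rewrite divr_gt0.
    by exists (W, e / 2) => //=; rewrite divr_gt0.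
  move=> [y [U d]] /= [yb [WU /andP[d0 de]]]; exists j => z zb; apply: bW => i iW.
  have := yb i iW; have := zb i (WU _ iW).
  have := ler_distD (y i) (x i) (z i); lra.
move=> [[W e] /= e0 /(_ (W, e)) H]; exists W, e => //.
by apply: H; split=> //=; rewrite e0 lexx.
Qed.

End boxes.

Definition unit_cube (R : realType) (I : Type) : set {ptws I -> R} :=
  [set x | forall i, 0 <= x i <= 1].

Lemma compact_unit_cube (R : realType) (I : eqType) : compact (@unit_cube R I).
Proof.
have := @tychonoff I (fun=> R) (fun=> `[(0 : R), 1]%classic).
have -> : [set f : forall i : I, R | forall i, `[(0 : R), 1]%classic (f i)] = @unit_cube R I.
  by apply/seteqP; split=> f Hf i; have := Hf i; rewrite /= in_itv.
by apply=> _; exact: segment_compact.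
Qed.

(** Each grid point [p] has a member [jj p] containing a box around it. Its color is a bottom face
    that [jj p] meets, or [None] if there is none, so distinct colors come from distinct members;
    near a point where all colors occur, [n + 1] members overlap. *)
Lemma lebesgue_covering (R : realType) n (J : Type)
    (B : J -> set {ptws 'I_n -> R}) :
  (forall j, open (B j)) ->
  (forall x, unit_cube x -> exists j, B j x) ->
  (forall j k x y, B j x -> B j y -> unit_cube x -> unit_cube y ->
     x k = 0 -> y k = 1 -> False) ->
  exists x s, [/\ unit_cube x, injective s &
    forall c : option 'I_n, B (s c) x].
Proof.
move=> oB cov faces.
have [W [e e0 leb]] := ptws_lebesgue_number (@compact_unit_cube R 'I_n) oB cov.
(* Points fewer than five grid steps apart must lie in a common box of radius [e]. *)
pose M := (Num.truncn (5 / e)).+1.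
have M0 : 0 < M%:R :> R by rewrite ltr0n.
have Me : 5 < e * M%:R.
  by rewrite mulrC -ltr_pdivrMr //; exact: truncnS_gt.
pose pt (p : {ffun 'I_n -> 'I_M.+1}) : {ptws 'I_n -> R} :=
  fun j => (p j)%:R / M%:R.
have pt01 p : unit_cube (pt p).
  move=> j; rewrite divr_ge0 ?ler0n //= ler_pdivrMr // mul1r ler_nat.
  by rewrite -ltnS ltn_ord.
have [jj Hjj] := choice (fun p => leb _ (pt01 p)).
have close (p q : {ffun 'I_n -> 'I_M.+1}) :
    (forall j, (p j < q j + 5 /\ q j < p j + 5)%N) -> B (jj p) (pt q).
  move=> pq; apply: Hjj => i _; rewrite /pt -mulrBl normrM normfV.
  rewrite (gtr0_norm M0) ltr_pdivrMr //; apply: le_lt_trans Me.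
  have [] := pq i; rewrite -!(ltr_nat R) !natrD.
  by rewrite ler_norml => ? ?; apply/andP; split; lra.
pose bottom j k := `[< exists x, [/\ B j x, unit_cube x & x k = 0] >].
pose cls j : option 'I_n := [pick k | bottom j k].
have clsS j k : cls j = Some k -> exists x, [/\ B j x, unit_cube x & x k = 0].
  by rewrite /cls; case: pickP => // k' /asboolP H [<-].
have clsN j k x : cls j = None -> B j x -> unit_cube x -> x k <> 0.
  rewrite /cls; case: pickP => // /(_ k) /asboolP H _ Bx x01 xk.
  by apply: H; exists x.
pose move_to (p : {ffun 'I_n -> 'I_M.+1}) k (c : R) : {ptws 'I_n -> R} :=
  fun j => if j == k then c else pt p j.
have move01 p k c : 0 <= c <= 1 -> unit_cube (move_to p k c).
  by move=> c01 j; rewrite /move_to; case: ifP => // _; apply: pt01.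
have moveB (p : {ffun 'I_n -> 'I_M.+1}) k (c : R) :
    `|(p k)%:R - c * M%:R| < 5 :> R -> B (jj p) (move_to p k c).
  move=> pkc; apply: Hjj => i _; rewrite /move_to.
  case: eqP => [->|_]; last by rewrite subrr normr0.
  rewrite -(ltr_pM2r M0) -[X in _ * X < _](gtr0_norm M0) -normrM mulrBl.
  by rewrite divfK ?gt_eqF //; exact: lt_trans pkc Me.
have [//|k p pk|k p pk|p Hp] :=
    @approximate_sperner n M (fun p => cls (jj p)) _.
- apply/eqP => /clsS[x [Bx x01 xk]].
  apply: (faces _ k _ (move_to p k 1) Bx _ x01 _ xk).
  + apply: moveB; rewrite mul1r distrC ger0_norm; last first.
      by rewrite subr_ge0 ler_nat -ltnS ltn_ord.
    by rewrite ltrBlDr addrC -natrD ltr_nat.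
  + by apply: move01; rewrite ler01 lexx.
  + by rewrite /move_to eqxx.
- apply/eqP => /clsN/(_ (moveB p k 0 _) (move01 _ _ _ _)) H; apply: (H k).
  + by rewrite mul0r subr0 normr_nat ltr_nat.
  + by rewrite ler01 lexx.
  + by rewrite /move_to eqxx.
have [q Hq] := choice (fun c => let: ex_intro2 q cq d := Hp c in
   ex_intro (fun q => cls (jj q) = c /\
      forall j, (p j < q j + 5 /\ q j < p j + 5)%N) q (conj cq d)).
exists (pt p), (fun c => jj (q c)); split=> // [c c' e1|c].
  by have [<- _] := Hq c; have [<- _] := Hq c'; rewrite e1.
by apply: close => j; have [_ /(_ j) []] := Hq c.
Qed.

(** * Bounds on the dimension of covers *)

Lemma sum_indic (R : realType) (Y : Type) (c : set (set Y)) y :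
  finite_set c -> \sum_(U \in c) (\1_U y : R) =
    (size [seq U <- enum_fset (fset_set c) | y \in U])%:R.
Proof.
move=> fc; rewrite fsbig_finite //= size_filter -sum1_count natr_sum.
rewrite [RHS]big_mkcond /=; apply: eq_bigr => U _.
by rewrite indicE; case: (y \in U).
Qed.

Lemma sum_indic_le (R : realType) (Y : Type) (N : finType) (Q : {set N})
    (s : N -> set Y) (c : set (set Y)) y : finite_set c ->
  (forall U, c U -> U y -> exists2 p, p \in Q & U = s p) ->
  \sum_(U \in c) (\1_U y : R) <= #|Q|%:R.
Proof.
move=> fc H; rewrite sum_indic // ler_nat cardE -(size_map s).
apply: uniq_leq_size => [|U]; first by rewrite filter_uniq // fset_uniq.
rewrite mem_filter in_fset_set // => /andP[/set_mem Uy /set_mem cU].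
by have [p pQ ->] := H _ cU Uy; apply: map_f; rewrite mem_enum.
Qed.

Lemma sum_indic_ge (R : realType) (Y : Type) (K : finType) (s : K -> set Y)
    (c : set (set Y)) y : finite_set c -> injective s ->
  (forall k, c (s k) /\ s k y) -> #|K|%:R <= \sum_(U \in c) (\1_U y : R).
Proof.
move=> fc s_inj H; rewrite sum_indic // ler_nat cardE -(size_map s).
apply: uniq_leq_size => [|U /mapP[k _ ->]]; first by rewrite map_inj_uniq ?enum_uniq.
by have [cs sy] := H k; rewrite mem_filter in_fset_set // !mem_set.
Qed.

(* The sets [freudenthal_star M p] are the open stars of the vertices of the
   Freudenthal triangulation of the grid of mesh [1 / M]; the integer points
   whose star contains [z] form a chain above the integer part of [M z]. *)
Definition freudenthal_star (R : realType) (N : finType) (M : nat)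
    (p : {ffun N -> 'I_M.+1}) (z : N -> R) : Prop :=
  (forall i, `|M%:R * z i - (p i)%:R| < 1) /\
  (forall i j, (M%:R * z i - (p i)%:R) - (M%:R * z j - (p j)%:R) < 1).

Lemma freudenthal_star_cover (R : realType) (N : finType) M (z : N -> R) :
  (forall i, 0 <= z i <= 1) ->
  exists p : {ffun N -> 'I_M.+1}, freudenthal_star p z.
Proof.
move=> z01; pose t i := Num.truncn (M%:R * z i).
have Mz0 i : 0 <= M%:R * z i.
  by rewrite mulr_ge0 ?ler0n //; have /andP[] := z01 i.
have tM i : (t i < M.+1)%N.
  rewrite ltnS -(ler_nat R); apply: le_trans (_ : M%:R * z i <= _).
    by rewrite truncn_le.
  by rewrite ler_piMr ?ler0n //; have /andP[] := z01 i.
exists [ffun i => Ordinal (tM i)].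
have frac i : 0 <= M%:R * z i - (t i)%:R < 1.
  rewrite subr_ge0 truncn_le //= ltrBlDr addrC natr1 Mz0; exact: truncnS_gt.
split=> [i|i j]; rewrite !ffunE /=.
  by rewrite ger0_norm; have /andP[] := frac i.
by have /andP[] := frac i; have /andP[] := frac j; lra.
Qed.

Lemma freudenthal_star_close (R : realType) (N : finType) M
    (p : {ffun N -> 'I_M.+1}) (z z' : N -> R) :
  freudenthal_star p z -> freudenthal_star p z' ->
  forall i, M%:R * `|z i - z' i| < 2.
Proof.
move=> [pz _] [pz' _] i; have := pz i; have := pz' i.
rewrite -[M%:R in X in _ -> _ -> X]normr_nat -normrM mulrBr.
rewrite !ltr_norml => /andP[? ?] /andP[? ?]; apply/andP; split; lra.
Qed.

(** A vertex [p] is determined by the set [up p] of coordinates that it rounds up. A zero coordinate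
    is never rounded up, so these sets form a chain inside the support of [z] and differ in
    cardinality. *)
Lemma freudenthal_star_card (R : realType) (N : finType) M (z : N -> R)
    (Q : {set {ffun N -> 'I_M.+1}}) :
  (forall p, p \in Q -> freudenthal_star p z) ->
  (#|Q| <= #|[pred i | z i != 0%R]|.+1)%N.
Proof.
move=> HQ; pose up (p : {ffun N -> 'I_M.+1}) : {set N} := [set i | M%:R * z i < (p i)%:R]%SET.
have up_supp p : p \in Q -> up p \subset [pred i | z i != 0].
  move=> /HQ[p1 _]; apply/fintype.subsetP => i; rewrite !inE.
  apply: contraTneq => zi; have := p1 i; rewrite zi !mulr0 sub0r normrN normr_nat.
  by rewrite -leNgt ltrn1 lern0 ltnS leqn0.
have integral (a b : nat) : (a%:R < b%:R + 1 :> R) -> (a <= b)%N.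
  by rewrite -ltnS -(ltr_nat R) -natr1.
have up_inj p q : p \in Q -> q \in Q -> up p = up q -> p = q.
  move=> /HQ[p1 _] /HQ[q1 _] /setP pq; apply/ffunP => i; apply: val_inj.
  have := p1 i; have := q1 i; have := pq i; rewrite !inE.
  rewrite !ltr_norml => pqi /andP[q2 q3] /andP[p2 p3]; apply/eqP.
  rewrite eqn_leq /=; apply/andP; split; apply: integral; move: pqi;
    by case: (ltP _ (p i)%:R); case: (ltP _ (q i)%:R) => // *; lra.
have chain p q : p \in Q -> q \in Q -> (up p \subset up q) || (up q \subset up p).
  move=> /HQ[p1 p2] /HQ[q1 q2]; case: (boolP (up p \subset up q)) => //=.
  move=> /fintype.subsetPn[i]; rewrite !inE -leNgt => pi qi; apply/fintype.subsetP => j.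
  rewrite !inE => qj; rewrite ltNge; apply/negP => pj.
  have pqi : (q i < p i)%N by rewrite -(ltr_nat R); apply: le_lt_trans pi.
  have pqj : (p j < q j)%N by rewrite -(ltr_nat R); apply: le_lt_trans qj.
  move: pqi pqj (p2 j i) (q2 i j).
  by rewrite -!(ler_nat R) -!natr1; lra.
pose h (p : {ffun N -> 'I_M.+1}) : 'I_(#|[pred i | z i != 0%R]|.+1) :=
  inord #|up p|.
have h_inj : {in Q &, injective h}.
  move=> p q pQ qQ /(congr1 val); rewrite /= !inordK ?ltnS ?subset_leq_card ?up_supp //.
  move=> e; apply: up_inj => //; apply/eqP.
  have := chain _ _ pQ qQ; rewrite eqEcard e leqnn andbT.
  by case/orP => // qp; have /eqP <- : up q == up p by rewrite eqEcard qp e leqnn.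
rewrite -(card_in_imset h_inj).
by apply: leq_trans (max_card _) _; rewrite card_ord.
Qed.

Lemma open_preimage_lt (R : realType) (Y : topologicalType) (f : Y -> R) r :
  continuous f -> open [set y | f y < r].
Proof.
move=> cf; have /continuousP/(_ [set x | x < r]) := cf; apply.
exact: open_lt.
Qed.

Lemma open_forall (Y : topologicalType) (N : finType) (s : N -> set Y) :
  (forall i, open (s i)) -> open [set y | forall i, s i y].
Proof.
move=> os; rewrite openE => y sy; apply: filter_forall => i.
exact: open_nbhs_nbhs.
Qed.

(** The open stars are pulled back along [z]: at most [D + 1] of them meet at a point, and the last
    hypothesis makes them refine [c]. *)
Lemma cover_dim_le (R : realType) (Y : topologicalType) (c : set (set Y))
    (N : finType) (z : N -> Y -> R) (M D : nat) :
  (forall i, continuous (z i)) -> (forall i y, 0 <= z i y <= 1) ->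
  (forall y, (#|[pred i | z i y != 0%R]| <= D)%N) ->
  (forall A : set Y,
     (forall y y', A y -> A y' -> forall i, M%:R * `|z i y - z i y'| < 2) ->
     exists2 U, c U & A `<=` U) ->
  (cover_dim R c <= D%:R%:E)%E.
Proof.
move=> cz z01 zD small.
pose st (p : {ffun N -> 'I_M.+1}) : set Y :=
  [set y | freudenthal_star p (fun i => z i y)].
pose b := [set st p | p in [set: {ffun N -> 'I_M.+1}]].
have fb : finite_set b by apply: finite_image; exact: finite_finset.
have ob : finite_open_cover b.
  split=> //.
  - move=> _ [p _ <-].
    pose s1 i := [set y | M%:R * z i y - (p i)%:R < 1] `&`
                 [set y | - (M%:R * z i y - (p i)%:R) < 1].
    pose s2 (ij : N * N) := [set y | (M%:R * z ij.1 y - (p ij.1)%:R) -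
                 (M%:R * z ij.2 y - (p ij.2)%:R) < 1].
    have -> : st p = [set y | forall i, s1 i y] `&` [set y | forall ij, s2 ij y].
      apply/seteqP; split=> y.
        move=> [p1 p2]; split=> [i|[i j]]; last exact: p2.
        by have := p1 i; rewrite ltr_norml /s1 /= => /andP[? ?]; split; lra.
      move=> [p1 p2]; split=> [i|i j]; last exact: (p2 (i, j)).
      by have [] := p1 i; rewrite ltr_norml /= => ? ?; apply/andP; split; lra.
    have cz' i : continuous (fun y => M%:R * z i y - (p i)%:R).
      move=> y; apply: cvgB; last exact: cvg_cst.
      by apply: cvgM; [exact: cvg_cst|exact: cz].
    apply: openI; apply: open_forall.
      move=> i; apply: openI; apply: open_preimage_lt => // y.
      by apply: cvgN; exact: cz'.
    by move=> [i j]; apply: open_preimage_lt => y; apply: cvgB; exact: cz'.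
  - apply/seteqP; split=> // y _.
    have [p sp] := @freudenthal_star_cover R N M (fun i => z i y) (fun i => z01 i y).
    by exists (st p) => //; exists p.
apply: ge_ereal_inf; exists (ord R b).
  exists b => //; split=> // _ [p _ <-]; apply: small => y y' py py' i.
  exact: (freudenthal_star_close py py' i).
apply: ge_ereal_sup => _ [y _ <-]; rewrite lee_fin lerBlDr natr1.
pose Q : {set {ffun N -> 'I_M.+1}} := [set p | `[< st p y >]]%SET.
apply: le_trans (sum_indic_le (Q := Q) (s := st) _ _ _) _ => //.
  move=> _ [p _ <-] py; exists p => //; rewrite inE; exact/asboolP.
rewrite ler_nat; apply: leq_trans (freudenthal_star_card (z := fun i => z i y) _) _.
  by move=> p; rewrite inE => /asboolP.
by rewrite ltnS; exact: zD.
Qed.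

(** A refinement of [c] pulls back to a cover of the cube without members joining opposite faces, so
    [n + 1] of its members share a point. *)
Lemma cover_dim_ge (R : realType) (Y : topologicalType) (c : set (set Y)) n
    (Psi : {ptws 'I_n -> R} -> Y) : continuous Psi ->
  (forall U k x y, c U -> U (Psi x) -> U (Psi y) ->
     unit_cube x -> unit_cube y -> x k = 0 -> y k = 1 -> False) ->
  (n%:R%:E <= cover_dim R c)%E.
Proof.
move=> cPsi faces; apply: le_ereal_inf_tmp => _ [b [[fb ob cb] bc] <-].
have [|||x [s [x01 s_inj sx]]] := @lebesgue_covering R n (set_type b)
    (fun U => Psi @^-1` (\val U)) _.
- by move=> U; have /continuousP := cPsi; apply; exact: ob (set_valP U).
- move=> x _; have : setT (Psi x) by []; rewrite -cb => -[U bU Ux].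
  by exists (exist _ U (mem_set bU)).
- move=> U k x y; have [V cV UV] := bc _ (set_valP U).
  by move=> /UV Vx /UV Vy; exact: faces cV Vx Vy.
apply: le_ereal_sup_tmp; exists (\sum_(U \in b) (\1_U (Psi x) : R) - 1)%:E.
  by exists (Psi x).
rewrite lee_fin lerBrDr natr1.
have := @sum_indic_ge R Y _ (fun k => \val (s k)) b (Psi x) fb.
rewrite card_option card_ord; apply.
  by move=> k k' /val_inj/s_inj.
by move=> k; split; [exact: set_valP|exact: sx].
Qed.

(** * Lower bound on mean dimension *)

Lemma limn_esup_le (R : realType) (u : nat -> \bar R) (x : \bar R) :
  (forall n, (u n <= x)%E) -> (limn_esup u <= x)%E.
Proof.
move=> ux; apply: ge_ereal_inf.
exists (ereal_sup (u @` setT)); first by exists setT => //; exact: filterT.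
by apply: ge_ereal_sup => _ [n _ <-].
Qed.

Lemma limn_esup_ge (R : realType) (u : nat -> \bar R) (x : \bar R) :
  (\forall n \near \oo, (x <= u n)%E) -> (x <= limn_esup u)%E.
Proof.
move=> ux; apply: le_ereal_inf_tmp => _ [A FA <-].
have [n [xn An]] := filter_ex (filterI ux FA).
by apply: le_ereal_sup_tmp; exists (u n) => //; exists n.
Qed.

Section clip.
Context {R : realType}.

(* The nearest point of [[0, 1]], written so that continuity is immediate. *)
Definition clip (r : R) : R := (`|r| - `|r - 1| + 1) / 2.

Lemma clipE r : clip r = if r <= 0 then 0 else if r <= 1 then r else 1.
Proof.
rewrite /clip; case: (leP r 0) => r0.
  rewrite (ler0_norm r0) ler0_norm; lra.
rewrite (gtr0_norm r0); case: (leP r 1) => r1.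
  by rewrite ler0_norm; lra.
by rewrite gtr0_norm; lra.
Qed.

Lemma clip_itv r : 0 <= clip r <= 1.
Proof. by rewrite clipE; case: (leP r 0); case: (leP r 1) => *; lra. Qed.

Lemma continuous_clip : continuous clip.
Proof.
move=> r; apply: cvgM; last exact: cvg_cst.
apply: cvgD; last exact: cvg_cst.
apply: cvgB; first exact: cvg_norm.
by apply: cvg_norm; apply: cvgB; [exact: cvg_id|exact: cvg_cst].
Qed.

End clip.

Definition indep_for (V : finType) (sigma : F2 -> {perm V}) (S : {set V}) : Prop :=
  forall v, v \in S -> sigma gen_a v \notin S /\ sigma gen_b v \notin S.

Section exact_microstates.
Context {R : realType} (V : finType) (sigma : F2 -> {perm V}) (S : {set V}).
Hypothesis sigmaM : forall g h v, sigma (g * h)%g v = sigma g (sigma h v).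
Hypothesis S_indep : indep_for sigma S.

Lemma hom1 v : sigma 1%g v = v.
Proof.
by apply: (@perm_inj _ (sigma 1%g)); rewrite -sigmaM mulg1.
Qed.

Lemma homK g v : sigma g (sigma g^-1%g v) = v.
Proof. by rewrite -sigmaM mulgV hom1. Qed.

(** [clip] extends the family of microstates from the cube to the whole space, on which
    [cover_dim_ge] expects its map. *)
Definition cube_extend (w : {ptws 'I_#|S| -> R}) (v : V) : R :=
  if [pick k | enum_val k == v] is Some k then clip (w k) else 0.

Lemma cube_extend_itv w v : 0 <= cube_extend w v <= 1.
Proof.
by rewrite /cube_extend; case: pickP => [k _|_]; rewrite ?clip_itv // lexx ler01.
Qed.

Lemma cube_extend_notin w v : v \notin S -> cube_extend w v = 0.
Proof.
rewrite /cube_extend; case: pickP => // k /eqP <-.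
by rewrite enum_valP.
Qed.

Lemma cube_extend_val w k : cube_extend w (enum_val k) = clip (w k).
Proof.
rewrite /cube_extend; case: pickP => [k' /eqP/enum_val_inj -> //|].
by move=> /(_ k); rewrite eqxx.
Qed.

Lemma cube_extend_continuous u :
  continuous (fun w : {ptws 'I_#|S| -> R} => cube_extend w u).
Proof.
have [uS|uS] := boolP (u \in S); last first.
  have -> : (fun w : {ptws 'I_#|S| -> R} => cube_extend w u) = cst 0.
    by apply/funext => w; exact: cube_extend_notin.
  exact: cst_continuous.
have -> : (fun w : {ptws 'I_#|S| -> R} => cube_extend w u) =
    clip \o (fun w : {ptws 'I_#|S| -> R} => w (enum_rank_in uS u)).
  by apply/funext => w; rewrite /= -cube_extend_val enum_rankK_in.
move=> w; apply: continuous_comp; first exact: continuous_eval.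
exact: continuous_clip.
Qed.

Lemma cube_microstate_subproof w v :
  hard_core_set (fun g => cube_extend w (sigma g^-1%g v)).
Proof.
split=> [g|g s sab]; first exact: cube_extend_itv.
(* The values at [g * s] and [g] are read at [u] and [sigma s u], the two ends of an edge. *)
set u := sigma (g * s)^-1%g v.
have -> : sigma g^-1%g v = sigma s u by rewrite /u invMg sigmaM homK.
have [uS|uS] := boolP (u \in S); last by rewrite (cube_extend_notin _ uS) mulr0.
rewrite (@cube_extend_notin _ (sigma s u)) ?mul0r //.
by have [] := S_indep uS; case: sab => ->.
Qed.

Definition cube_microstate w : {ptws V -> hard_core R} :=
  fun v => exist (fun x : {ptws F2 -> R} => x \in @hard_core_set R)
    (fun g => cube_extend w (sigma g^-1%g v))
    (mem_set (cube_microstate_subproof w v)).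

Lemma cube_microstate_continuous : continuous cube_microstate.
Proof.
apply: continuous_into_ptws => v; apply: continuous_comp_initial.
apply: continuous_into_ptws => g.
change (continuous (fun w => cube_extend w (sigma g^-1%g v))).
exact: cube_extend_continuous.
Qed.

Variable rho : hard_core R -> hard_core R -> R.
Hypothesis rho0 : forall x, rho x x = 0.
Variables (F : set F2) (delta : R).
Hypothesis delta0 : 0 <= delta.

Lemma cube_microstate_Map w :
  Map (hard_core_action R) rho F delta sigma (cube_microstate w).
Proof.
move=> s _; rewrite /rho2 big1 ?mulr0 ?sqrtr0 // => v _.
suff -> : cube_microstate w (sigma s v) = hard_core_shift s (cube_microstate w v).
  by rewrite rho0 expr0n.
apply: val_inj; apply/funext => g /=; rewrite /lshift_F2.
by rewrite invMg invgK sigmaM.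
Qed.

Definition cube_map w : set_type (Map (hard_core_action R) rho F delta sigma) :=
  exist (fun phi => phi \in Map (hard_core_action R) rho F delta sigma)
    (cube_microstate w) (mem_set (cube_microstate_Map w)).

Lemma cube_map_continuous : continuous cube_map.
Proof. apply: continuous_comp_initial; exact: cube_microstate_continuous. Qed.

(** In the product of this two-set cover no member meets both faces [0] and [1] of a coordinate. *)
Definition below1 : set (hard_core R) := [set x | \val x 1%g < 1].
Definition above0 : set (hard_core R) := [set x | - \val x 1%g < 0].

Lemma cover_dim_Map_ge :
  (#|S|%:R%:E <= cover_dim R (prod_cover [set below1; above0]
     (A := Map (hard_core_action R) rho F delta sigma)))%E.
Proof.
apply: (@cover_dim_ge R _ _ _ cube_map); first exact: cube_map_continuous.
move=> _ k x y [u cu ->] /= /(_ (enum_val k)) ux /(_ (enum_val k)) uy _ _ xk yk.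
have val1 w : \val (cube_microstate w (enum_val k)) 1%g = clip (w k).
  change (cube_extend w (sigma 1^-1%g (enum_val k)) = clip (w k)).
  by rewrite invg1 hom1 cube_extend_val.
case: (cu (enum_val k)) => e; move: ux uy; rewrite e => ux uy.
  have : clip (y k) < 1 by rewrite -val1; exact: uy.
  by rewrite yk clipE ler10 lexx ltxx.
have : - clip (x k) < 0 by rewrite -val1; exact: ux.
by rewrite xk clipE lexx oppr0 ltxx.
Qed.

End exact_microstates.

Lemma continuous_hard_core_coord (R : realType) g :
  continuous (fun x : hard_core R => \val x g : R).
Proof.
move=> x; apply: (@continuous_comp _ _ _ (\val : hard_core R -> {ptws F2 -> R})
   (fun y : {ptws F2 -> R} => y g)).
  exact: continuous_val.
exact: continuous_eval.
Qed.

Lemma below1_above0_cover (R : realType) :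
  finite_open_cover [set @below1 R; @above0 R].
Proof.
split.
- exact: finite_set2.
- move=> _ [->|->]; apply: open_preimage_lt.
    exact: continuous_hard_core_coord.
  move=> x; apply: continuousN; exact: (@continuous_hard_core_coord R 1%g x).
- apply/seteqP; split=> // x _; have [x1|x1] := ltP (\val x 1%g) 1.
    by exists (@below1 R) => //; left.
  by exists (@above0 R); [right|rewrite /above0 /= oppr_lt0; exact: lt_le_trans x1].
Qed.

Lemma compatible_metric_refl (R : realType) (X : topologicalType)
    (rho : X -> X -> R) x : compatible_metric rho -> rho x x = 0.
Proof. by case=> /(_ x x)[_ ->]. Qed.

Lemma mdim_ge (R : realType) (Sigma : hom_sofic_approximation R F2) (t : R)
    (rho : hard_core R -> hard_core R -> R) : compatible_metric rho ->
  (\forall n \near \oo, exists2 S : {set sofic_set Sigma n},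
     indep_for (@sofic_map R F2 Sigma n) S &
     t * #|sofic_set Sigma n|%:R <= #|S|%:R) ->
  (t%:E <= mdim Sigma (hard_core_action R) rho)%E.
Proof.
move=> crho ev; apply: le_ereal_sup_tmp.
eexists; first by exists [set @below1 R; @above0 R];
  [exact: below1_above0_cover|reflexivity].
apply: le_ereal_inf_tmp => _ [F _ <-].
apply: le_ereal_inf_tmp => _ [delta /= d0 <-].
apply: limn_esup_ge; have cardV := @sofic_card R F2 Sigma.
near=> n.
have V0 : (0 < #|sofic_set Sigma n|)%N.
  by near: n; apply: (cardV [set m | (0 < m)%N]); exists 1%N.
have [S iS tS] : exists2 S : {set sofic_set Sigma n},
     indep_for (@sofic_map R F2 Sigma n) S &
     t * #|sofic_set Sigma n|%:R <= #|S|%:R by near: n.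
rewrite lee_pdivlMr ?ltr0n // -EFinM.
apply: le_trans (cover_dim_Map_ge (@sofic_mapM R F2 Sigma n) iS (rho := rho)
   (fun x => compatible_metric_refl x crho) F (ltW d0)).
by rewrite lee_fin.
Unshelve. all: by end_near. Qed.

(** * Upper bound on mean dimension *)

Section hard_core_topology.
Context {R : realType}.

Lemma compact_hard_core_set : compact (@hard_core_set R).
Proof.
pose P := {ptws F2 -> R}.
have -> : @hard_core_set R = @unit_cube R F2 `&`
    \bigcap_(gs in [set gs : F2 * F2 | gs.2 = gen_a \/ gs.2 = gen_b])
      [set x : P | x gs.1 * x (gs.1 * gs.2)%g = 0].
  apply/seteqP; split=> x [x01 x0]; split=> //.
    by move=> [g s] /= sab; exact: x0.
  by move=> g s sab; exact: (x0 (g, s)).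
apply: compact_closedI; first exact: compact_unit_cube.
apply: closed_bigI => -[g s] _ /=.
have cf : continuous (fun x : P => x g * x (g * s)%g).
  move=> x; have cg := @continuous_eval F2 R g x.
  have cgs := @continuous_eval F2 R (g * s)%g x.
  exact: (continuousM cg cgs).
have /continuous_closedP/(_ [set 0]) := cf; apply.
exact: closed_eq.
Qed.

Lemma hard_core_lebesgue_number (c : set (set (hard_core R))) :
  finite_open_cover c -> exists W, exists2 e, 0 < e &
    forall x : hard_core R, exists2 U, c U &
      forall y : hard_core R, box W e (\val x) (\val y) -> U y.
Proof.
move=> [_ oc cov].
pose J := {O : set {ptws F2 -> R} | open O /\ c (\val @^-1` O)}.
have [||x Kx|W [e e0 leb]] := @ptws_lebesgue_number R F2 (@hard_core_set R) J sval.
- exact: compact_hard_core_set.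
- by move=> j; exact: (svalP j).1.
- have : setT (exist _ x (mem_set Kx) : hard_core R) by [].
  rewrite -cov => -[U cU Ux].
  have [G oG GU] := oc U cU; rewrite -GU in cU Ux.
  by exists (exist _ G (conj oG cU)).
exists W, e => // x; have [[G [oG cG]] /= bG] := leb _ (set_valP x).
by exists (\val @^-1` G) => // y /bG.
Qed.

(** Compactness is available in [{ptws F2 -> R}], whereas [rho] lives on the subspace; the
    quantifier over [a] with [\val a = x] links the two. *)
Lemma hard_core_unif_continuous (rho : hard_core R -> hard_core R -> R) g k :
  compatible_metric rho -> 0 < k ->
  exists2 r, 0 < r & forall x y, rho x y < r -> `|\val x g - \val y g| < k.
Proof.
move=> [_ _ rhoD rhoN] k0.
have /compact_near_coveringP cK := compact_hard_core_set.
have : \forall r \near (0 : R)^'+, @hard_core_set R `<=`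
    [set x | forall a y : hard_core R, \val a = x -> rho a y < r ->
       `|\val a g - \val y g| < k].
  apply: cK => x Kx; pose b : hard_core R := exist _ x (mem_set Kx).
  have k2 : 0 < k / 2 by rewrite divr_gt0.
  have nb : nbhs b [set y : hard_core R | `|\val b g - \val y g| < k / 2].
    apply: (@continuous_hard_core_coord R g b [set r | `|\val b g - r| < k / 2]).
    exact: (@nbhsx_ballx _ _ (\val b g : R) (k / 2)).
  have [e e0 eb] := (rhoN _ _).1 nb.
  have e2 : 0 < e / 2 by rewrite divr_gt0.
  have nb' : nbhs b ([set y | rho b y < e / 2] `&`
      [set y : hard_core R | `|\val b g - \val y g| < k / 2]).
    by apply: filterI => //; apply/rhoN; exists (e / 2).
  move: nb'; rewrite nbhsE => -[_ [[G oG <-] Gb] Gsub].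
  exists (G, [set r | r <= e / 2]) => /=.
    split; first exact: open_nbhs_nbhs.
    exact: nbhs_right_le.
  move=> [z r] /= [Gz re] a y az ay.
  have Ga : (\val @^-1` G) a by rewrite /= az.
  have [ba bag] := Gsub a Ga.
  have by' : rho b y < e.
    by apply: le_lt_trans (rhoD b a y) _; move: ba ay re => /= *; lra.
  have byg := eb y by'.
  have := ler_distD (\val b g) (\val a g) (\val y g).
  have bag' : `|\val b g - \val a g| < k / 2 := bag.
  have byg' : `|\val b g - \val y g| < k / 2 := byg.
  by move: bag' byg'; rewrite (distrC (\val a g) (\val b g)); lra.
move=> H; have [r [r0 Hr]] := filter_ex (filterI (nbhs_right_gt 0) H).
by exists r => // x y; apply: (Hr _ (set_valP x)).
Qed.

End hard_core_topology.

(** * Encoding of approximate microstates *)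

Section approximate_microstates.
Context {R : realType} (V : finType) (sigma : F2 -> {perm V}).
Hypothesis sigmaM : forall g h v, sigma (g * h)%g v = sigma g (sigma h v).
Variables (W : seq F2) (kappa : R).
Hypotheses (kappa0 : 0 < kappa) (Wa : gen_a \in W) (Wb : gen_b \in W).
Local Notation k := (size W).
Local Notation X := {ptws V -> hard_core R}.
Implicit Types (phi : X) (v : V).

Definition coord phi v g : R := \val (phi v) g.

Definition defect phi v : R :=
  \sum_(g <- W) `|coord phi v g - coord phi (sigma g^-1%g v) 1%g|.

(** A continuous cutoff: [0] up to defect [kappa] and [1] from [2 * kappa] on. *)
Definition badness phi v : R := clip (defect phi v / kappa - 1).

Definition bad phi : {set V} := [set v | badness phi v != 0]%SET.

Definition occupied phi : {set V} := [set v | clip (coord phi v 1%g - kappa) != 0]%SET.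

(* Away from the few bad vertices the values [coord phi v g] with [g] in [W]
   are determined, up to a small error, by the numbers [coord phi u 1]; at the
   bad vertices they are recorded separately. *)
Definition encode phi (i : V * option (option 'I_k)) : R :=
  match i.2 with
  | None => clip (coord phi i.1 1%g - kappa)
  | Some None => badness phi i.1
  | Some (Some j) => badness phi i.1 * coord phi i.1 (nth 1%g W j)
  end.

Lemma coord_itv phi v g : 0 <= coord phi v g <= 1.
Proof. by have [H _] := set_valP (phi v); exact: H. Qed.

Lemma coord_continuous v g : continuous (fun phi => coord phi v g).
Proof.
move=> phi.
apply: (@continuous_comp X (hard_core R) R (fun psi => psi v) (fun x => \val x g)).
  exact: continuous_eval.
exact: continuous_hard_core_coord.
Qed.

Lemma badness_continuous v : continuous (fun phi => badness phi v).
Proof.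
move=> phi; apply: (@continuous_comp X R R (fun psi => defect psi v / kappa - 1) clip).
  have cd : continuous (fun psi => defect psi v).
    rewrite /defect; elim: W => [|g W' IH] psi.
      have -> : (fun psi0 : X => \sum_(g <- [::])
         `|coord psi0 v g - coord psi0 (sigma g^-1%g v) 1%g|) = cst 0.
        by apply/funext => ?; rewrite big_nil.
      exact: cst_continuous.
    have -> : (fun psi0 : X => \sum_(h <- g :: W')
         `|coord psi0 v h - coord psi0 (sigma h^-1%g v) 1%g|) =
       (fun psi0 : X => `|coord psi0 v g - coord psi0 (sigma g^-1%g v) 1%g|) \+
       (fun psi0 : X => \sum_(h <- W')
         `|coord psi0 v h - coord psi0 (sigma h^-1%g v) 1%g|).
      by apply/funext => ?; rewrite big_cons.
    apply: continuousD; last exact: IH.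
    apply: (@continuous_comp X R R (fun psi0 : X => coord psi0 v g -
      coord psi0 (sigma g^-1%g v) 1%g) Num.norm); last exact: norm_continuous.
    by apply: continuousB; exact: coord_continuous.
  apply: continuousB; last exact: cst_continuous.
  by apply: continuousM; [exact: cd|exact: cst_continuous].
exact: continuous_clip.
Qed.

Lemma encode_continuous i : continuous (fun phi => encode phi i).
Proof.
move: i => [v [[j|]|]]; rewrite /encode /=.
- move=> phi; have cb := @badness_continuous v phi.
  have cc := @coord_continuous v (nth 1%g W j) phi.
  exact: (continuousM cb cc).
- exact: badness_continuous.
- move=> phi; apply: (@continuous_comp X R R (fun psi => coord psi v 1%g - kappa) clip).
    by apply: continuousB; [exact: coord_continuous|exact: cst_continuous].
  exact: continuous_clip.
Qed.

Lemma encode_itv phi i : 0 <= encode phi i <= 1.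
Proof.
move: i => [v [[j|]|]]; rewrite /encode /= ?clip_itv //.
have /andP[b0 b1] := clip_itv (defect phi v / kappa - 1).
have /andP[c0 c1] := coord_itv phi v (nth 1%g W j).
by rewrite mulr_ge0 //= mulr_ile1.
Qed.

Lemma defect_ge phi v g : g \in W ->
  `|coord phi v g - coord phi (sigma g^-1%g v) 1%g| <= defect phi v.
Proof.
by move=> gW; rewrite /defect (big_rem g) //= lerDl sumr_ge0.
Qed.

Lemma bad_defect phi v : (v \in bad phi) = (kappa < defect phi v).
Proof.
rewrite inE /badness clipE subr_le0 ler_pdivrMr // mul1r.
case: ltP => d; last by rewrite eqxx.
case: ifP => _; first by rewrite gt_eqF // subr_gt0 ltr_pdivlMr // mul1r.
by rewrite oner_eq0.
Qed.

Lemma occupied_coord phi v : (v \in occupied phi) = (kappa < coord phi v 1%g).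
Proof.
rewrite inE clipE subr_le0; case: ltP => d; last by rewrite eqxx.
by case: ifP => _; rewrite ?oner_eq0 // gt_eqF // subr_gt0.
Qed.

(** The hard-core condition at [sigma s v] annihilates its value or its coordinate at [s]. If
    [sigma s v] is good, the latter is within [kappa] of the value at [v], so the two values cannot
    both exceed [kappa]. *)
Lemma occupied_indep phi : indep_for sigma (occupied phi :\: bad phi)%SET.
Proof.
move=> v vD.
suff H s : s = gen_a \/ s = gen_b -> s \in W ->
    sigma s v \notin (occupied phi :\: bad phi)%SET.
  by split; apply: H; auto.
move=> sab sW; rewrite finset.in_setD bad_defect occupied_coord.
rewrite -leNgt; apply/negP => /andP[good occ].
have := defect_ge phi (sigma s v) sW; rewrite -sigmaM mulVg hom1 //.
have [_ /(_ 1%g s sab)] := set_valP (phi (sigma s v)).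
rewrite mul1g => /eqP; rewrite mulf_eq0 => /orP[/eqP c0|/eqP c0].
  by move: occ; rewrite /coord c0 ltNge ltW.
move: vD; rewrite finset.in_setD occupied_coord => /andP[_ vocc].
rewrite {1}/coord c0 sub0r normrN ger0_norm; last by have /andP[] := coord_itv phi v 1%g.
move: good vocc; lra.
Qed.

(** A bad vertex costs at most [k + 2]: its own value, its badness and [k] recorded coordinates. *)
Lemma card_encode_support phi (alpha : nat) :
  (forall S, indep_for sigma S -> #|S| <= alpha)%N ->
  (#|[pred i | encode phi i != 0%R]| <= alpha + (k + 2) * #|bad phi|)%N.
Proof.
move=> Halpha.
have sub : [set i | encode phi i != 0]%SET \subset
   (finset.setX (occupied phi) [set None] :|: finset.setX (bad phi) [set~ None])%SET.
  apply/fintype.subsetP => -[v [[j|]|]]; rewrite !inE /encode /=.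
  - by rewrite mulf_eq0 negb_or => /andP[-> _]; rewrite orbT.
  - by move=> ->; rewrite orbT.
  - by move=> ->.
have -> : #|[pred i | encode phi i != 0]| = #|[set i | encode phi i != 0]%SET|.
  by apply: eq_card => i; rewrite !inE.
apply: leq_trans (subset_leq_card sub) _.
apply: leq_trans (leq_card_setU _ _).1 _; rewrite !cardsX cards1 muln1.
rewrite cardsC1 !card_option card_ord /=.
have := Halpha _ (@occupied_indep phi).
have := subset_leq_card (finset.subsetIr (occupied phi) (bad phi)).
by rewrite -(cardsID (bad phi) (occupied phi)); lia.
Qed.

(** If the badness of [phi] is at least [1 / 2], dividing by it gives the error [4 * tau]. Otherwise
    both defects are below [2 * kappa], and comparing through the value at [sigma g^-1 v], known up
    to [kappa + tau], gives [5 * kappa + tau]. *)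
Lemma encode_close phi psi (tau : R) : 0 < tau -> tau <= 1 / 2 ->
  (forall i, `|encode phi i - encode psi i| < tau) ->
  forall v g, g \in W ->
  `|coord phi v g - coord psi v g| < 5 * kappa + 4 * tau.
Proof.
move=> tau0 tau1 close v g gW; have k0 := kappa0.
have cb := close (v, Some None); rewrite /encode /= in cb.
have [b_ge|b_lt] := leP (1 / 2) (badness phi v).
  have gj : (index g W < k)%N by rewrite index_mem.
  have := close (v, Some (Some (Ordinal gj))); rewrite /encode /= nth_index //.
  have /andP[c0 c1] := coord_itv psi v g.
  set b := badness phi v in cb b_ge *; set b' := badness psi v in cb *.
  set x := coord phi v g; set y := coord psi v g in c0 c1 *.
  move=> cx.
  have e : b * (x - y) = (b * x - b' * y) - (b - b') * y by lra.
  have n1 : `|b * (x - y)| < tau + tau.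
    rewrite e; apply: le_lt_trans (ler_normB _ _) _; apply: ltrD => //.
    rewrite normrM; apply: le_lt_trans cb; rewrite ler_piMr //.
    by rewrite ger0_norm.
  have n2 : 1 / 2 * `|x - y| <= `|b * (x - y)|.
    by rewrite normrM ler_wpM2r // ger0_norm //; lra.
  by lra.
have b'_lt : badness psi v < 1.
  by move: cb; rewrite ltr_norml => /andP[? ?]; lra.
have defect_lt chi : badness chi v < 1 -> defect chi v < 2 * kappa.
  rewrite /badness clipE; case: (leP (defect chi v / kappa - 1) 0) => [d _|_].
    by move: d; rewrite subr_le0 ler_pdivrMr //; lra.
  case: (leP (defect chi v / kappa - 1) 1) => [_|]; last by rewrite ltxx.
  by rewrite ltrBlDr ltr_pdivrMr //; lra.
have b_lt1 : badness phi v < 1 by lra.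
have d1 := le_lt_trans (defect_ge phi v gW) (defect_lt _ b_lt1).
have d2 := le_lt_trans (defect_ge psi v gW) (defect_lt _ b'_lt).
have := close (sigma g^-1%g v, None); rewrite /encode /=.
set u := sigma _ v in d1 d2 *.
have [/andP[p0 p1] /andP[q0 q1]] := (coord_itv phi u 1%g, coord_itv psi u 1%g).
move: d1 d2; rewrite !clipE; set x := coord phi v g; set y := coord psi v g.
set p := coord phi u _ in p0 p1 *; set q := coord psi u _ in q0 q1 *.
have -> : p - kappa <= 1 by lra.
have -> : q - kappa <= 1 by lra.
rewrite !ltr_norml => /andP[? ?] /andP[? ?].
by case: (leP (p - kappa) 0) => ?; case: (leP (q - kappa) 0) => ? /andP[? ?];
  apply/andP; split; lra.
Qed.

Section bad_vertices.
Variable rho : hard_core R -> hard_core R -> R.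
Variables r : R.
Hypotheses (r0 : 0 < r) (rhoP : forall x y, rho x y < r ->
  `|\val x 1%g - \val y 1%g| < kappa / k%:R).

(** Chebyshev's inequality: at a bad vertex some [g] in [W] has an error of at least [r]. Inverses
    occur because the coordinate of a point at [g] is that of its shift by [g^-1] at [1]. *)
Lemma card_bad phi (delta : R) :  0 <= delta ->
  Map (hard_core_action R) rho [set g^-1%g | g in [set` W]] delta sigma phi ->
  #|bad phi|%:R * r ^+ 2 <= k%:R * (#|V|%:R * delta ^+ 2).
Proof.
move=> d0 Mphi.
have k0 : (0 < k)%N by case: (W) Wa.
have bound g : g \in W -> \sum_v rho (phi (sigma g^-1%g v))
      (hard_core_shift g^-1%g (phi v)) ^+ 2 <= #|V|%:R * delta ^+ 2.
  move=> gW; have /Mphi : [set h^-1%g | h in [set` W]] g^-1%g by exists g.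
  rewrite /rho2 => le.
  have [V0|V0] := posnP #|V|.
    by rewrite big1 ?V0 ?mul0r // => v _; have := fintype0 v V0.
  have s0 : 0 <= #|V|%:R^-1 * \sum_v rho (phi (sigma g^-1%g v))
      (hard_core_shift g^-1%g (phi v)) ^+ 2.
    by rewrite mulr_ge0 ?invr_ge0 ?ler0n // sumr_ge0 // => v _; exact: sqr_ge0.
  move: le; rewrite -(@ler_pXn2r _ 2) ?nnegrE ?sqrtr_ge0 // sqr_sqrtr //.
  by rewrite mulrC ler_pdivrMr ?ltr0n // mulrC.
have one v : v \in bad phi -> r ^+ 2 <=
    \sum_(g <- W) rho (phi (sigma g^-1%g v)) (hard_core_shift g^-1%g (phi v)) ^+ 2.
  rewrite bad_defect => dv; rewrite leNgt; apply/negP => small.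
  move: dv; apply/negP; rewrite -leNgt /defect.
  have -> : kappa = \sum_(g <- W) kappa / k%:R.
    by rewrite big_const_seq count_predT iter_addr_0 -[RHS]mulr_natr divfK // pnatr_eq0 -lt0n.
  rewrite big_seq [X in _ <= X]big_seq; apply: ler_sum => g gW.
  have rg : rho (phi (sigma g^-1%g v)) (hard_core_shift g^-1%g (phi v)) < r.
    rewrite ltNge; apply/negP => rge; move: small; apply/negP; rewrite -leNgt.
    rewrite (big_rem g) //=; apply: ler_wpDr.
      by apply: sumr_ge0 => h _; exact: sqr_ge0.
    by rewrite ler_pXn2r ?nnegrE // ltW // (lt_le_trans r0).
  have := rhoP rg; rewrite /= /lshift_F2 invgK mulg1 distrC; exact: ltW.
rewrite mulr_natl -sumr_const.
apply: le_trans (_ : \sum_(g <- W) #|V|%:R * delta ^+ 2 <= _); last first.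
  by rewrite big_const_seq count_predT iter_addr_0 -[X in X <= _]mulr_natl.
rewrite big_seq; apply: le_trans (ler_sum _ bound); rewrite -big_seq exchange_big /=.
apply: le_trans (ler_sum _ one) _.
rewrite big_mkcond; apply: ler_sum => v _; case: ifP => // _.
by apply: sumr_ge0 => h _; exact: sqr_ge0.
Qed.

End bad_vertices.

End approximate_microstates.

Lemma hard_core_set0 (R : realType) : hard_core_set (fun=> 0 : R).
Proof. by split=> [g|g s _]; rewrite ?mulr0 // lexx ler01. Qed.

Definition hard_core0 (R : realType) : hard_core R :=
  exist (fun x : {ptws F2 -> R} => x \in @hard_core_set R) (fun=> 0)
    (mem_set (@hard_core_set0 R)).

Lemma cover_dim_Map_le (R : realType) (V : finType) (sigma : F2 -> {perm V})
    (rho : hard_core R -> hard_core R -> R) (W : seq F2)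
    (c : set (set (hard_core R))) (kappa tau r delta eps : R) (alpha : nat) :
  (forall g h v, sigma (g * h)%g v = sigma g (sigma h v)) ->
  0 < kappa -> gen_a \in W -> gen_b \in W ->
  (forall x : hard_core R, exists2 U, c U &
     forall y : hard_core R, box W (5 * kappa + 4 * tau) (\val x) (\val y) -> U y) ->
  0 < tau -> tau <= 1 / 2 -> 0 < r -> 0 <= delta ->
  (forall x y, rho x y < r -> `|\val x 1%g - \val y 1%g| < kappa / (size W)%:R) ->
  (forall S, indep_for sigma S -> #|S| <= alpha)%N ->
  (size W + 2)%:R * ((size W)%:R * delta ^+ 2) <= eps * r ^+ 2 ->
  (cover_dim R (prod_cover c
     (A := Map (hard_core_action R) rho [set g^-1%g | g in [set` W]] delta sigma))
   <= (alpha%:R + eps * #|V|%:R)%:E)%E.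
Proof.
move=> sM kappa0 Wa Wb leb tau0 tau1 r0 d0 rhoP Halpha small.
set Y := Map _ _ _ _ _; set k := size W.
have eps0 : 0 <= eps.
  rewrite -(pmulr_lge0 _ (exprn_gt0 2 r0)); apply: le_trans small.
  by rewrite !mulr_ge0 // sqr_ge0.
pose D := Num.truncn (alpha%:R + eps * #|V|%:R).
have D0 : 0 <= alpha%:R + eps * #|V|%:R by rewrite addr_ge0 // mulr_ge0.
apply: (@le_trans _ _ (D%:R%:E)); last by rewrite lee_fin truncn_le.
pose M := (Num.truncn (2 / tau)).+1.
have M0 : 0 < M%:R :> R by rewrite ltr0n.
have Mtau : 2 < M%:R * tau by rewrite -ltr_pdivrMr //; exact: truncnS_gt.
have := @cover_dim_le R (set_type Y) (prod_cover c (A := Y)) (V * option (option 'I_k))%type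
  (fun i (y : set_type Y) => encode (W := W) sigma kappa (\val y) i) M D.
apply.
- move=> i y; apply: (@continuous_comp (set_type Y) {ptws V -> hard_core R} R
    (\val) (fun phi => encode (W := W) sigma kappa phi i)).
    exact: continuous_val.
  exact: encode_continuous.
- by move=> i y; exact: encode_itv.
- move=> y; rewrite /D truncn_ge_nat //.
  apply: le_trans (_ : (alpha + (k + 2) * #|bad sigma W kappa (\val y)|)%:R <= _).
    by rewrite ler_nat; apply: card_encode_support.
  rewrite natrD lerD2l natrM -(ler_pM2r (exprn_gt0 2 r0)).
  have k2 : 0 < (k + 2)%:R :> R by rewrite ltr0n addn_gt0 orbT.
  have := card_bad kappa0 Wa r0 rhoP d0 (set_valP y) => /(ler_wpM2l (ltW k2)).
  by have := ler_wpM2r (ler0n R #|V|) small; rewrite -/k; lra.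
- move=> A closeA.
  have [u Hu] : exists u : V -> set (hard_core R), forall v,
      c (u v) /\ forall y, A y -> u v (\val y v).
    have [[y0 Ay0]|/set0P/negP/negPn/eqP ->] := pselect (A !=set0).
      suff /choice[u Hu] : forall v, exists U, c U /\ forall y, A y -> U (\val y v).
        by exists u.
      move=> v; have [U cU HU] := leb (\val y0 v).
      exists U; split=> // y Ay; apply: HU => g gW.
      apply: (@encode_close R V sigma W kappa kappa0 (\val y0) (\val y) tau) => // i.
      by rewrite -(ltr_pM2l M0); apply: lt_trans Mtau; exact: closeA.
    (* For empty [A] the zero configuration merely supplies some member of [c]. *)
    have [U cU _] := leb (hard_core0 R).
    by exists (fun=> U).
  exists [set phi : set_type Y | forall v, u v (\val phi v)].
    by exists u => // v; have [] := Hu v.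
  by move=> y Ay v; have [_] := Hu v; apply.
Qed.

Lemma mdim_le (R : realType) (Sigma : hom_sofic_approximation R F2) (t : R)
    (rho : hard_core R -> hard_core R -> R) : compatible_metric rho -> 0 <= t ->
  (forall n (S : {set sofic_set Sigma n}), indep_for (@sofic_map R F2 Sigma n) S ->
     #|S|%:R <= t * #|sofic_set Sigma n|%:R) ->
  (mdim Sigma (hard_core_action R) rho <= t%:E)%E.
Proof.
move=> crho t0 St; apply: ge_ereal_sup => _ [c /= fc <-].
apply/lee_addgt0Pr => eps eps0.
have [W0 [e e0 leb0]] := hard_core_lebesgue_number fc.
pose W := [:: gen_a, gen_b & W0]; pose k := size W.
(* Chosen so that [5 * kappa + 4 * tau <= e], the error in [encode_close]. *)
pose kappa := e / 10; pose tau := Num.min (e / 8) (1 / 2).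
have kappa0 : 0 < kappa by rewrite divr_gt0.
have tau0 : 0 < tau by rewrite lt_min !divr_gt0.
have tau1 : tau <= 1 / 2 by rewrite ge_min lexx orbT.
have taue : tau <= e / 8 by rewrite ge_min lexx.
have k0 : 0 < k%:R :> R by rewrite ltr0n.
have [r r0 rhoP] := hard_core_unif_continuous 1%g crho (divr_gt0 kappa0 k0).
pose eps1 := Num.min 1 eps / (k + 2)%:R.
have m0 : 0 < Num.min 1 eps by rewrite lt_min ltr01.
have k2 : 0 < (k + 2)%:R :> R by rewrite ltr0n addn_gt0 orbT.
have eps10 : 0 < eps1 by rewrite divr_gt0.
have eps11 : eps1 <= 1.
  rewrite ler_pdivrMr // mul1r; apply: (@le_trans _ _ 1); first by rewrite ge_min lexx.
  by rewrite ler1n addn_gt0 orbT.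
(* With this choice the bad vertices cost [(k + 2) * k * delta ^ 2 / r ^ 2 = (k + 2) * eps1 * (eps1
   / k) <= eps] per vertex. *)
pose delta := r * eps1 / k%:R.
have delta0 : 0 < delta by rewrite divr_gt0 // mulr_gt0.
apply: ge_ereal_inf; eexists.
  exists [set g^-1%g | g in [set` W]]; last reflexivity.
  split; first by apply: finite_image; exact: finite_seq.
  by exists gen_a^-1%g, gen_a => //=; rewrite inE eqxx.
apply: ge_ereal_inf; eexists; first by exists delta; [exact: delta0|reflexivity].
apply: limn_esup_le => n.
have [V0|V0] := posnP #|sofic_set Sigma n|.
  by rewrite V0 invr0 mule0 -EFinD lee_fin addr_ge0 // ltW.
rewrite lee_pdivrMr ?ltr0n // -EFinD -EFinM.
pose alpha := Num.truncn (t * #|sofic_set Sigma n|%:R).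
apply: le_trans (@cover_dim_Map_le R _ _ rho W c kappa tau r delta eps alpha
  (@sofic_mapM R F2 Sigma n) kappa0 _ _ _ tau0 tau1 r0 (ltW delta0) rhoP _ _) _.
- by rewrite inE eqxx.
- by rewrite !inE eqxx orbT.
- move=> x; have [U cU HU] := leb0 x; exists U => // y yb; apply: HU => g gW.
  apply: lt_le_trans (yb g _) _; first by rewrite !inE gW !orbT.
  by rewrite /kappa; lra.
- move=> S iS; rewrite truncn_ge_nat; first exact: St.
  by rewrite mulr_ge0.
- rewrite -/k.
  have -> : (k + 2)%:R * (k%:R * delta ^+ 2) =
     ((k + 2)%:R * eps1) * (eps1 / k%:R) * r ^+ 2.
    have -> : delta ^+ 2 = (r ^+ 2 * eps1 ^+ 2 * k%:R^-1) / k%:R.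
      by rewrite /delta !exprMn expr2 -!mulrA.
    rewrite [k%:R * _]mulrC divfK ?gt_eqF //; lra.
  rewrite ler_wpM2r ?sqr_ge0 //.
  have -> : (k + 2)%:R * eps1 = Num.min 1 eps by rewrite mulrC divfK // gt_eqF.
  apply: (@le_trans _ _ (Num.min 1 eps * 1)).
    rewrite ler_wpM2l ?(ltW m0) // ler_pdivrMr // mul1r; apply: le_trans eps11 _.
    by rewrite ler1n.
  by rewrite mulr1 ge_min lexx orbT.
rewrite lee_fin mulrDl lerD2r truncn_le //.
by rewrite mulr_ge0.
Qed.

(** * Topological mixing *)

Lemma hard_core_open_box (R : realType) (U : set (hard_core R)) x :
  open U -> U x -> exists W, exists2 e, 0 < e &
    forall y : hard_core R, box W e (\val x) (\val y) -> U y.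
Proof.
move=> [G oG <-] Gx.
have [W [e e0 bG]] := nbhs_ptwsP (open_nbhs_nbhs (conj oG Gx)).
by exists W, e => // y /bG.
Qed.

(** For [g] outside [K] the windows [g W1] and [W2] are disjoint and joined by no edge, so the shift
    of [x] on the first, [y] on the second and [0] elsewhere satisfy the hard-core condition. *)
Lemma hard_core_mixing (R : realType) :
  topologically_mixing (hard_core_action R).
Proof.
move=> U V oU oV [x Ux] [y Vy].
have [W1 [e1 e10 bU]] := hard_core_open_box oU Ux.
have [W2 [e2 e20 bV]] := hard_core_open_box oV Vy.
pose N : seq F2 := [:: 1%g; gen_a; gen_b; gen_a^-1%g; gen_b^-1%g].
pose K := [seq (hs.1 * hs.2 * k^-1)%g | hs <- [seq (h, s) | h <- W2, s <- N], k <- W1].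
exists [set` K]; first exact: finite_seq.
move=> g gK.
have notK h s k : h \in W2 -> s \in N -> k \in W1 -> g = (h * s * k^-1)%g -> False.
  move=> hW sN kW e; apply: gK; rewrite /= e.
  apply: (allpairs_f (fun hs k => (hs.1 * hs.2 * k^-1)%g) (x := (h, s))) => //.
  exact: allpairs_f.
pose z h : R := if (g^-1 * h)%g \in W1 then \val x (g^-1 * h)%g
                else if h \in W2 then \val y h else 0.
have [x01 x0] := set_valP x; have [y01 y0] := set_valP y.
have zhc : hard_core_set z.
  split=> [h|h s sab].
    by rewrite /z; do 2?case: ifP => _; rewrite ?x01 ?y01 // lexx ler01.
  have sN : s \in N by case: sab => ->; rewrite !inE eqxx ?orbT.
  have sVN : s^-1%g \in N by case: sab => ->; rewrite !inE eqxx ?orbT.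
  rewrite /z mulgA.
  case: (boolP ((g^-1 * h)%g \in W1)) => k1;
    case: (boolP ((g^-1 * h * s)%g \in W1)) => k2.
  - exact: x0.
  - case: ifP => h2; last by rewrite mulr0.
    by case: (@notK (h * s)%g s^-1%g (g^-1 * h)%g) => //; rewrite mulgK invMg invgK mulKVg.
  - case: ifP => h1; last by rewrite mul0r.
    case: (@notK h s (g^-1 * h * s)%g) => //.
    by rewrite !invMg invgK !mulgA mulgK mulgV mul1g.
  - case: ifP => h1; last by rewrite mul0r.
    case: ifP => h2; last by rewrite mulr0.
    exact: y0.
pose zh : hard_core R :=
  exist (fun x : {ptws F2 -> R} => x \in @hard_core_set R) z (mem_set zhc).
exists zh; split.
  exists (hard_core_shift g^-1%g zh); last first.
    by rewrite /= -hard_core_shiftM mulgV hard_core_shift1.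
  apply: bU => k kW; change (`|\val x k - z (g^-1^-1 * k)%g| < e1).
  by rewrite /z invgK mulKg kW subrr normr0.
apply: bV => h hW; change (`|\val y h - z h| < e2).
rewrite /z hW; case: ifP => k1; last by rewrite subrr normr0.
case: (@notK h 1%g (g^-1 * h)%g) => //.
by rewrite mulg1 invMg invgK mulKVg.
Qed.

(** * The two sofic approximations *)

Section permutation_homomorphism.
Variables (T : finType) (P : {ffun bool -> {perm T}}).

Definition hom_perm (g : F2) : {perm T} := perm (@wact_inj T P (word g)).

Lemma hom_permE g v : hom_perm g v = wact P (word g) v.
Proof. exact: permE. Qed.

Lemma hom_permM g h v : hom_perm (g * h)%g v = hom_perm g (hom_perm h v).
Proof. by rewrite !hom_permE wact_wmul. Qed.

Lemma hom_perm_indep (S : {set T}) : indep_for hom_perm S -> indep P S.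
Proof.
move=> HS; apply/forallP => s; apply/pred0P => v /=.
apply/negP => /andP[vS /imsetP[u uS vu]].
have [na nb] := HS _ uS; move: vS; rewrite vu.
by case: s {vu} => vS; [move: nb|move: na]; rewrite hom_permE /= /lact /= vS.
Qed.

Definition loops : {set T} :=
  [set v | (hom_perm gen_a v == v) || (hom_perm gen_b v == v)]%SET.

(* The vertices without loop that are outside a maximal independent set are
   adjacent to it. *)
Lemma exists_large_indep : exists2 S : {set T}, indep_for hom_perm S &
  (#|T| <= 5 * #|S| + #|loops|)%N.
Proof.
set a := hom_perm gen_a; set b := hom_perm gen_b.
pose ind (S : {set T}) := [forall v in S, (a v \notin S) && (b v \notin S)].
have ind0 : ind finset.set0 by apply/forall_inP => v; rewrite inE.
case: (@arg_maxnP _ finset.set0 ind (fun S => #|S|) ind0) => S indS maxS.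
exists S.
  by move=> v vS; have /forall_inP/(_ v vS)/andP := indS.
have cover : [set: T]%SET \subset (loops :|: (S :|: ((a @: S) :|: ((b @: S) :|:
    ((a @^-1: S) :|: (b @^-1: S))))))%SET.
  apply/fintype.subsetP => v _; rewrite !inE; apply: contraT.
  rewrite !negb_or => /and5P[/andP[na nb] vS vaS vbS /andP[avS bvS]].
  have /maxS : ind (v |: S)%SET.
    apply/forall_inP => u; rewrite !inE => /orP[/eqP ->|uS].
      by rewrite !negb_or -/a -/b na nb avS bvS.
    have /forall_inP/(_ u uS)/andP[nau nbu] := indS.
    rewrite !negb_or nau nbu !andbT; apply/andP; split.
      by apply: contraNneq vaS => <-; apply: imset_f.
    by apply: contraNneq vbS => <-; apply: imset_f.
  by rewrite cardsU1 vS /=; lia.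
have := subset_leq_card cover; rewrite cardsT => le; apply: leq_trans le _.
have cU (A B : {set T}) n m : (#|A| <= n -> #|B| <= m -> #|A :|: B| <= n + m)%N.
  by move=> An Bm; apply: leq_trans (leq_card_setU _ _).1 _; exact: leq_add.
have -> : (5 * #|S| + #|loops| =
    #|loops| + (#|S| + (#|S| + (#|S| + (#|S| + #|S|)))))%N by lia.
apply: (cU) => //; apply: (cU) => //; apply: (cU); first exact: leq_imset_card.
apply: (cU); first exact: leq_imset_card.
by apply: (cU); rewrite card_preimset //; exact: perm_inj.
Qed.

End permutation_homomorphism.

(** * The bipartite double cover *)

Section double_cover.
Variables (T : finType) (P : {ffun bool -> {perm T}}).

Lemma double_fun_inj (s : bool) :
  injective (fun u : T * bool => (P s u.1, ~~ u.2)).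
Proof. by move=> [u e] [v f] [/perm_inj -> /negb_inj ->]. Qed.

Definition double_perms : {ffun bool -> {perm (T * bool)}} :=
  [ffun s => perm (@double_fun_inj s)].

Lemma lact_double x u : lact double_perms x u = (lact P x u.1, ~~ u.2).
Proof.
rewrite /lact ffunE; case: x.2; last exact: permE.
apply: (@perm_inj _ (perm (@double_fun_inj x.1))).
by rewrite permKV permE /= permKV negbK; case: u.
Qed.

Lemma wact_double w u : (wact double_perms w u).1 = wact P w u.1.
Proof. by elim: w => //= x w <-; rewrite lact_double. Qed.

Lemma card_double_fixes w :
  (#|[set u | wact double_perms w u == u]%SET| <=
   2 * #|[set v | wact P w v == v]%SET|)%N.
Proof.
have -> : (2 * #|[set v | wact P w v == v]%SET|)%N =
    #|finset.setX [set v | wact P w v == v]%SET [set: bool]%SET|.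
  by rewrite cardsX cardsT card_bool mulnC.
apply: subset_leq_card; apply/fintype.subsetP => u; rewrite !inE andbT.
by move=> /eqP e; rewrite -[X in _ == X.1]e wact_double.
Qed.

Lemma double_indep : indep_for (hom_perm double_perms) [set u | u.2]%SET.
Proof.
by move=> u; rewrite !inE !hom_permE /= !lact_double /= => ->.
Qed.

Lemma card_double_half : #|[set u : T * bool | u.2]%SET| = #|T|.
Proof.
have -> : [set u : T * bool | u.2]%SET = finset.setX [set: T]%SET [set true]%SET.
  by apply/setP => u; rewrite !inE /= eqb_id.
by rewrite cardsX cardsT cards1 muln1.
Qed.

End double_cover.

(** [S] and its image under the generator [a] are disjoint and have the same size. *)
Lemma indep_card_half (V : finType) (sigma : F2 -> {perm V}) (S : {set V}) :
  indep_for sigma S -> (2 * #|S| <= #|V|)%N.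
Proof.
move=> iS; have dis : [disjoint S & sigma gen_a @: S]%B.
  apply/pred0P => v /=; apply/negP => /andP[vS /imsetP[u uS vu]].
  by have [] := iS _ uS; rewrite -vu vS.
rewrite mul2n -addnn -[X in (_ + X)%N](card_imset _ (@perm_inj _ (sigma gen_a))).
move: dis; rewrite -(leq_card_setU S (sigma gen_a @: S)).2 => /eqP <-.
exact: max_card.
Qed.

(** Stage [n] controls only the nontrivial elements with code below [n]; each element is controlled
    from some stage on. *)
Definition first_words n : seq (seq letter) :=
  [seq word g | g <- pmap (@choice.unpickle F2) (iota 0 n) & g != 1%g].

Lemma mem_first_words (g : F2) n : g <> 1%g -> (choice.pickle g < n)%N ->
  word g \in first_words n.
Proof.
move=> /eqP g1 gn; apply: map_f; rewrite mem_filter g1 mem_pmap /=.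
by apply/mapP; exists (choice.pickle g); rewrite ?mem_iota // choice.pickleK.
Qed.

Lemma exists_good_permutations n :
  exists mP : {m : nat & {ffun bool -> {perm 'I_(20 * m)}}},
  [/\ (n < tag mP)%N,
     forall g : F2, g <> 1%g -> (choice.pickle g < n)%N ->
       (n.+1 * #|[set v | wact (tagged mP) (word g) v == v]%SET| <= 20 * tag mP)%N &
     forall S, indep (tagged mP) S -> (#|S| < 9 * tag mP)%N].
Proof.
pose L := first_words n; pose l := (\max_(w <- L) size w)%N.
(* The first summand makes the sets grow, the second meets the size condition of [good_permutations]
   with [q = n.+1]. *)
pose m := (n.+1 + (l + 4 * size L * (n.+1 * l ^ 2)))%N.
have HL w : w \in L -> [/\ reduced w, w != [::] & (size w <= l)%N].
  move=> wL; split; last exact: (leq_bigmax_seq w).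
    by move: wL => /mapP[g _ ->]; exact: word_reduced.
  move: wL => /mapP[g]; rewrite mem_filter => /andP[g1 _] ->.
  by apply: contraNneq g1 => e; apply/eqP/val_inj.
have m0 : (0 < m)%N by [].
have lm : (l + 4 * size L * (n.+1 * l ^ 2) <= 20 * m)%N by rewrite /m; lia.
have [P [fP iP]] := good_permutations HL m0 (ltn0Sn n) lm.
exists (Tagged (fun m => {ffun bool -> {perm 'I_(20 * m)}}) P); split=> //=.
  by rewrite /m; lia.
by move=> g g1 gn; apply: fP; exact: mem_first_words.
Qed.

(** * From sequences of permutations to sofic approximations *)

Section sofic_sequences.
Variables (R : realType) (T : nat -> finType)
  (P : forall n, {ffun bool -> {perm (T n)}}).
Hypothesis T_large : forall n, (n <= #|T n|)%N.
Hypothesis P_free : forall n (g : F2), g <> 1%g -> (choice.pickle g < n)%N ->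
  (n.+1 * #|[set v | wact (P n) (word g) v == v]%SET| <= #|T n|)%N.

Lemma sofic_card_subproof : (fun n => #|T n|) @ \oo --> \oo.
Proof.
move=> A [N _ NA]; exists N => // n /= Nn; apply: NA => /=.
exact: leq_trans (T_large n).
Qed.

Lemma fixed_ratio_le n (g : F2) : g <> 1%g -> (choice.pickle g < n)%N ->
  #|[pred v | hom_perm (P n) g v == v]|%:R / #|T n|%:R <= n.+1%:R^-1 :> R.
Proof.
move=> g1 gn; have T0 : (0 < #|T n|)%N by apply: leq_trans (T_large n); lia.
rewrite ler_pdivrMr ?ltr0n // ler_pdivlMl ?ltr0n // -natrM ler_nat.
apply: leq_trans (P_free g1 gn); rewrite leq_mul2l /=; apply/eq_leq.
by apply: eq_card => v; rewrite !inE hom_permE.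
Qed.

Lemma sofic_free_subproof g : g <> 1%g ->
  (#|[pred v | hom_perm (P n) g v == v]|%:R / #|T n|%:R : R) @[n --> \oo] --> (0 : R).
Proof.
move=> g1; apply/cvgr0Pnorm_le => e e0; near=> n.
have gn : (choice.pickle g < n)%N by near: n; exists (choice.pickle g).+1.
rewrite ger0_norm ?divr_ge0 ?ler0n //; apply: le_trans (fixed_ratio_le g1 gn) _.
by near: n; have := near_infty_natSinv_lt (PosNum e0); apply: filterS => n /ltW.
Unshelve. all: by end_near. Qed.

Definition sofic_of_permutations : hom_sofic_approximation R F2 :=
  @HomSoficApproximation R F2 T (fun n => hom_perm (P n))
    (fun n => @hom_permM (T n) (P n)) sofic_card_subproof sofic_free_subproof.

End sofic_sequences.

Lemma mdim_double_half (R : realType) (T : nat -> finType)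
    (P : forall n, {ffun bool -> {perm (T n)}})
    (large : forall n, (n <= #|{: T n * bool}|)%N)
    (free : forall n (g : F2), g <> 1%g -> (choice.pickle g < n)%N ->
      (n.+1 * #|[set v | wact (double_perms (P n)) (word g) v == v]%SET| <=
         #|{: T n * bool}|)%N)
    (rho : hard_core R -> hard_core R -> R) :
  compatible_metric rho ->
  mdim (sofic_of_permutations R large free) (hard_core_action R) rho = (1 / 2)%:E.
Proof.
move=> crho; apply/eqP; rewrite eq_le; apply/andP; split.
  apply: mdim_le => [//||n S iS]; first by rewrite divr_ge0.
  have := indep_card_half iS; rewrite -(ler_nat R) natrM.
  by move: (#|S|%:R : R) (#|_|%:R : R) => x y; lra.
apply: mdim_ge => //; near=> n.
exists [set u | u.2]%SET; first exact: double_indep.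
rewrite card_double_half /= card_prod card_bool natrM; lra.
Unshelve. all: by end_near. Qed.

Lemma card_loops (T : finType) (P : {ffun bool -> {perm T}}) :
  (#|loops P| <= #|[pred v | hom_perm P gen_a v == v]| +
                 #|[pred v | hom_perm P gen_b v == v]|)%N.
Proof.
rewrite -(cardUI [pred v | hom_perm P gen_a v == v] [pred v | hom_perm P gen_b v == v]).
apply: leq_trans (leq_addr _ _); apply: subset_leq_card.
by apply/fintype.subsetP => v; rewrite !inE.
Qed.

(** At most [2 * d * t] vertices have loops, so [s] is at least [(1 / 5 - 2 / 5 * d) * t]. *)
Lemma density_bound (R : realFieldType) (t s l a b : nat) (d e : R) :
  0 < t%:R :> R -> a%:R / t%:R <= d -> b%:R / t%:R <= d ->
  (t <= 5 * s + l)%N -> (l <= a + b)%N -> d < e -> (1 / 5 - e) * t%:R <= s%:R.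
Proof.
move=> t0; rewrite !ler_pdivrMr // => at_ bt; rewrite -!(ler_nat R).
rewrite natrD natrM [(a + b)%:R]natrD.
by move=> ts lab de; have := ler_wpM2r (ltW t0) (ltW de); have := ler0n R a; lra.
Qed.

Theorem theorem1p2 (R : realType) :
  topologically_mixing (hard_core_action R) /\
  exists Sigma_unif Sigma_bip : hom_sofic_approximation R F2,
    forall rho : hard_core R -> hard_core R -> R, compatible_metric rho ->
      [/\ ((1 / 5)%:E <= mdim Sigma_unif (hard_core_action R) rho)%E,
          (mdim Sigma_unif (hard_core_action R) rho <= (9 / 20)%:E)%E,
          ((9 / 20)%:E < (1 / 2)%:E :> \bar R)%E &
          mdim Sigma_bip (hard_core_action R) rho = (1 / 2)%:E].
Proof.
split; first exact: hard_core_mixing.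
have [mP HmP] := choice exists_good_permutations.
pose P n := tagged (mP n).
have large n : (n <= #|'I_(20 * tag (mP n))|)%N.
  by rewrite card_ord; have [] := HmP n; lia.
have free n (g : F2) : g <> 1%g -> (choice.pickle g < n)%N ->
    (n.+1 * #|[set v | wact (P n) (word g) v == v]%SET| <= #|'I_(20 * tag (mP n))|)%N.
  by move=> g1 gn; rewrite card_ord; have [_ + _] := HmP n; apply.
(* The second approximation is the double cover of the first, from which it inherits growth and
   freeness. *)
have large2 n : (n <= #|{: 'I_(20 * tag (mP n)) * bool}|)%N.
  by rewrite card_prod card_bool; apply: leq_trans (large n) _; rewrite leq_pmulr.
have free2 n (g : F2) : g <> 1%g -> (choice.pickle g < n)%N ->
    (n.+1 * #|[set v | wact (double_perms (P n)) (word g) v == v]%SET| <=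
       #|{: 'I_(20 * tag (mP n)) * bool}|)%N.
  move=> g1 gn; rewrite card_prod card_bool.
  apply: leq_trans (leq_mul (leqnn n.+1) (card_double_fixes (P n) (word g))) _.
  by rewrite mulnCA mulnC leq_mul2r free.
exists (sofic_of_permutations R large free), (sofic_of_permutations R large2 free2).
move=> rho crho; split; last exact: mdim_double_half.
(* Loops are rare but may be present, so each stage gives density [1 / 5] only up to [e]. *)
- apply/lee_subgt0Pr => e e0; rewrite -EFinB; apply: mdim_ge => //.
  near=> n.
  have [S iS cS] := exists_large_indep (P n); exists S; first exact: iS.
  have ga : gen_a <> 1%g by move=> /(congr1 word).
  have gb : gen_b <> 1%g by move=> /(congr1 word).
  have na : (choice.pickle gen_a < n)%N by near: n; exists (choice.pickle gen_a).+1.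
  have nb : (choice.pickle gen_b < n)%N by near: n; exists (choice.pickle gen_b).+1.
  have la := @fixed_ratio_le R _ _ large free n _ ga na.
  have lb := @fixed_ratio_le R _ _ large free n _ gb nb.
  have ne : n.+1%:R^-1 < e.
    by near: n; exact: (near_infty_natSinv_lt (PosNum e0)).
  have T0 : 0 < #|'I_(20 * tag (mP n))|%:R :> R.
    by rewrite ltr0n; apply: leq_trans (large n); lia.
  have cl := card_loops (P n).
  exact: (density_bound T0 la lb cS cl ne).
- apply: mdim_le => [//||n S /hom_perm_indep iS]; first by rewrite divr_ge0.
  have [_ _ /(_ S iS)] := HmP n; rewrite /= card_ord => /ltnW.
  by rewrite -(ler_nat R) !natrM; lra.
- by rewrite lte_fin; lra.
Unshelve. all: by end_near. Qed.
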